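(* Let $w$ be a positive integer and let $\chi$ be a primitive Dirichlet character with conductor $f\in\mathbb{N}$, $f\equiv 1 \pmod 2$. Define the multiple generalized Genocchi numbers $G_{n,\chi}^{(w)}$ attached to $\chi$ by $$\sum_{n=0}^{\infty}G_{n,\chi}^{(w)}\frac{t^n}{n!}=(2t)^w\sum_{a_1,\dots,a_w=1}^{f}\frac{(-1)^{a_1+\cdots+a_w}\chi(a_1+\cdots+a_w)\,e^{t(a_1+\cdots+a_w)}}{(e^{ft}+1)^w},\qquad |t|<\frac{\pi}{f},$$ and define, for $\operatorname{Re}(s)>w$, $$L^{(w)}(s\mid\chi)=2^w\sum_{n_1,\dots,n_w=1}^{\infty}\frac{\chi(n_1+\cdots+n_w)\,(-1)^{n_1+\cdots+n_w}}{(n_1+\cdots+n_w)^s}.$$ Then $L^{(w)}(s\mid\chi)$ admits an analytic continuation to the whole complex plane, and for every $n\in\mathbb{N}$, $$L^{(w)}(-n\mid\chi)=\frac{G_{n+w,\chi}^{(w)}}{\binom{n+w}{w}\,w!}.$$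
   Context: $\mathbb{N}=\{1,2,3,\dots\}$. The value $L^{(w)}(-n\mid\chi)$ means the value of the analytic continuation of the Dirichlet series above (which converges absolutely for $\operatorname{Re}(s)>w$). The function $L^{(w)}(s\mid\chi)$ is called the Dirichlet-type multiple Genocchi $L$-function. *)

(* Defs.v *)
From mathcomp Require Export all_boot all_order all_algebra.
From mathcomp Require Export complex finmap.
From mathcomp Require Export all_classical all_reals all_analysis.
From mathcomp Require summability.

Set Implicit Arguments.
Unset Strict Implicit.
Unset Printing Implicit Defensive.

Export Order.TTheory GRing.Theory Num.Theory.
Export numFieldNormedType.Exports.

Local Open Scope classical_set_scope.
Local Open Scope ring_scope.
Local Open Scope complex_scope.

(* [R[i]^o] is [R[i]] seen as a normed module over itself: this is the
   structure that carries the topology of the complex plane. *)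

Section complex_functions.
Variable R : realType.

Definition expC (z : R[i]) : R[i] :=
  (expR (complex.Re z))%:C * (cos (complex.Im z) +i* sin (complex.Im z)).

(* N ^ s = e ^ (s log N); meaningful for N > 0 *)
Definition natpowC (N : nat) (s : R[i]) : R[i] := expC (s * (ln N%:R)%:C).

(* derivability in direction 1 over the field R[i] is complex
   differentiability *)
Definition entire (F : R[i] -> R[i]) : Prop :=
  forall z : R[i], derivable (F : R[i]^o -> R[i]^o) z 1.

End complex_functions.

Section dirichlet_characters.
Variable R : realType.

Record dirichlet_character (q : nat) (chi : int -> R[i]) : Prop :=
  DirichletCharacter {
    dchar1 : chi 1 = 1;
    dcharM : forall m n : int, chi (m * n) = chi m * chi n;
    dchar_period : forall n : int, chi (n + q%:Z) = chi n;
    dchar_neq0 : forall n : int, (chi n != 0) = coprimez n q%:Z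
  }.

Definition induced_modulus (q : nat) (chi : int -> R[i]) (d : nat) : Prop :=
  (d %| q)%N /\
  exists2 chi0 : int -> R[i], dirichlet_character d chi0 &
    forall n : int, coprimez n q%:Z -> chi n = chi0 n.

Definition has_conductor (q : nat) (chi : int -> R[i]) (c : nat) : Prop :=
  induced_modulus q chi c /\
  forall d : nat, induced_modulus q chi d -> (c <= d)%N.

Definition primitive_character (f : nat) (chi : int -> R[i]) : Prop :=
  [/\ (0 < f)%N, dirichlet_character f chi & has_conductor f chi f].

End dirichlet_characters.

Section genocchi.
Variable R : realType.

(* The indices a_j = 1, ..., f are encoded as (a j).+1 with a j : 'I_f. *)
Definition genocchi_gf (w f : nat) (chi : int -> R[i]) (t : R[i]) : R[i] :=
  (2 * t) ^+ w *
  \sum_(a : {ffun 'I_w -> 'I_f})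
    (let A := (\sum_(j < w) (a j).+1)%N in
     (-1) ^+ A * chi A%:Z * expC (t * A%:R) / (expC (f%:R * t) + 1) ^+ w).

(* The coefficients of a convergent power series are unique, so this determines
   G; the disc is the largest one centred at 0 without zero of e^(ft) + 1. *)
Definition genocchi_numbers (w f : nat) (chi : int -> R[i])
    (G : nat -> R[i]) : Prop :=
  forall t : R[i], `|t| < (pi / f%:R)%:C ->
    series (fun n : nat => G n * (t ^+ n / n`!%:R) : R[i]^o) @ \oo
      --> (genocchi_gf w f chi t : R[i]^o).

(* The indices n_j = 1, 2, ... are encoded as (k j).+1 with k j : nat. *)
Definition genocchi_L_term (w : nat) (chi : int -> R[i]) (s : R[i])
    (k : {ffun 'I_w -> nat}) : R[i]^o :=
  let N := (\sum_(j < w) (k j).+1)%N in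
  chi N%:Z * (-1) ^+ N / natpowC N s.

(* Convergence along the finite sets of indices ordered by inclusion; in the
   complex plane this is the same as absolute convergence. *)
Definition genocchi_L_cvg (w : nat) (chi : int -> R[i]) (s : R[i]) : Prop :=
  cvg (summability.partial_sum (genocchi_L_term (w:=w) chi s)
         @ summability.totally).

Definition genocchi_L (w : nat) (chi : int -> R[i]) (s : R[i]) : R[i] :=
  2 ^+ w * (summability.sum (genocchi_L_term (w:=w) chi s) : R[i]).

End genocchi.

(* Main.v *)
Require Import Defs.
From mathcomp Require Import ring lra zify.
Set Implicit Arguments.
Unset Strict Implicit.
Unset Printing Implicit Defensive.
Local Open Scope classical_set_scope.
Local Open Scope ring_scope.
Local Open Scope complex_scope.

(** Write c(N) = (-1)^N chi(N), so that c(N + f) = - c(N) since f is odd, and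
    let D be the difference operator (D g)(N) = g(N) - g(N + f). Grouping the
    indices n_j modulo f turns the L-series into the sum over
    a_1, ..., a_w in [1, f], with A = a_1 + ... + a_w, of c(A) times
    2^w (1 + E)^(-w) g_s evaluated at A, where E g(N) = g(N + f) and
    g_s(N) = N^(-s). As 1 + E = 2 - D, Euler's transformation replaces
    (1 + E)^(-w) by the series in j of C(j + w - 1, w - 1) 2^(-j - w) D^j.

    This last series (of the kind Hasse used for zeta) converges for every s,
    together with its termwise derivative: D^m g_s(N) decays like N^(- Re s - m),
    and averaging 1/((i+1)...(i+r)) against the binomial weights 2^(-j) C(j, i)
    gains a factor of order j^(-r). Hence it defines an entire function.

    For s = - n the series is finite, since D^j kills polynomials of degree
    less than j. On the other side e^(tA) / (e^(ft) + 1)^w is the same series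
    applied to g(N) = e^(tN), for which D^j g(A) = (1 - e^(ft))^j e^(tA) is
    O(t^j); comparing Taylor coefficients at t = 0 along real t > 0 gives the
    values. *)

Local Notation Re := complex.Re.
Local Notation Im := complex.Im.
Local Notation total k := (\sum_j (k j).+1)%N.

(** * The modulus on [R[i]] as a real number *)

Section modulus.
Variable R : realType.
Implicit Types (x y : R) (z u v : R[i]).

(** Unlike [|z|], which is an element of [R[i]], this modulus lives in [R], whose order is total. *)
Definition modc (z : R[i]) : R := ComplexField.Normc.normc z.

Lemma normE z : `|z| = (modc z)%:C.
Proof. by rewrite normc_def /modc; case: z. Qed.

Lemma modc0 : modc 0 = 0. Proof. exact: ComplexField.Normc.normc0. Qed.
Lemma modc1 : modc 1 = 1. Proof. exact: ComplexField.Normc.normc1. Qed.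
Lemma modc_ge0 z : 0 <= modc z. Proof. by case: z => a b; apply: sqrtr_ge0. Qed.
Lemma modcD u v : modc (u + v) <= modc u + modc v. Proof. exact: le_normcD. Qed.
Lemma modcN z : modc (- z) = modc z. Proof. exact: normcN. Qed.
Lemma modcB u v : modc (u - v) <= modc u + modc v.
Proof. by rewrite -(modcN v); apply: modcD. Qed.
Lemma modcM u v : modc (u * v) = modc u * modc v.
Proof. exact: ComplexField.Normc.normcM. Qed.
Lemma modcV z : modc z^-1 = (modc z)^-1.
Proof. exact: ComplexField.Normc.normcV. Qed.
Lemma modc_eq0 z : (modc z == 0) = (z == 0).
Proof.
apply/eqP/eqP => [/ComplexField.Normc.eq0_normc //|->]; exact: modc0.
Qed.
Lemma modc_gt0 z : (0 < modc z) = (z != 0).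
Proof. by rewrite lt0r modc_eq0 modc_ge0 andbT. Qed.
Lemma modcX z n : modc (z ^+ n) = modc z ^+ n.
Proof. by elim: n => [|n IH]; rewrite ?expr0 ?modc1// !exprS modcM IH. Qed.
Lemma modc_distC u v : modc (u - v) = modc (v - u).
Proof. by rewrite -modcN opprB. Qed.
Lemma modc_real x : modc x%:C = `|x|.
Proof. by rewrite /modc /= expr0n addr0 sqrtr_sqr. Qed.
Lemma modc_nat n : modc n%:R = n%:R.
Proof. by rewrite -(rmorph_nat (real_complex R)) modc_real ger0_norm. Qed.
Lemma modc_Re z : `|Re z| <= modc z.
Proof.
case: z => a b /=; rewrite /modc /= -sqrtr_sqr ler_wsqrtr // lerDl sqr_ge0 //.
Qed.
Lemma modc_Im z : `|Im z| <= modc z.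
Proof.
case: z => a b /=; rewrite /modc /= -sqrtr_sqr ler_wsqrtr // lerDr sqr_ge0 //.
Qed.
Lemma modc_ReIm z : modc z <= `|Re z| + `|Im z|.
Proof.
rewrite {1}(complexE z); apply: le_trans (modcD _ _) _.
have mi : modc (complex.Complex 0 1 : R[i]) = 1 by rewrite /modc /= expr0n expr1n add0r sqrtr1.
by rewrite modcM !modc_real mi mul1r.
Qed.
Lemma modc_sum (I : Type) (r : seq I) (P : pred I) (F : I -> R[i]) :
  modc (\sum_(i <- r | P i) F i) <= \sum_(i <- r | P i) modc (F i).
Proof.
elim/big_ind2: _ => [|u a v b ua vb|//]; first by rewrite modc0.
by apply: le_trans (modcD _ _) _; apply: lerD.
Qed.

End modulus.

(** * The complex exponential *)

Section complex_exponential.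
Variable R : realType.
Implicit Types (x y : R) (z u v : R[i]).

Lemma ReD u v : Re (u + v) = Re u + Re v. Proof. by case: u; case: v. Qed.
Lemma ImD u v : Im (u + v) = Im u + Im v. Proof. by case: u; case: v. Qed.
Lemma ReN u : Re (- u) = - Re u. Proof. by case: u. Qed.
Lemma ImN u : Im (- u) = - Im u. Proof. by case: u. Qed.
Lemma ReM u v : Re (u * v) = Re u * Re v - Im u * Im v.
Proof. by case: u; case: v. Qed.
Lemma ImM u v : Im (u * v) = Re u * Im v + Im u * Re v.
Proof. by case: u; case: v. Qed.
Lemma eqC u v : Re u = Re v -> Im u = Im v -> u = v.
Proof. by case: u => a b; case: v => c d /= -> ->. Qed.

Lemma expC0 : expC (0 : R[i]) = 1.
Proof. by rewrite /expC /= expR0 cos0 sin0 mul1r. Qed.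
Lemma expCD u v : expC (u + v) = expC u * expC v.
Proof.
rewrite /expC ReD ImD expRD cosD sinD; apply: eqC;
rewrite !(ReM, ImM) /=; ring.
Qed.
Lemma modc_expC z : modc (expC z) = expR (Re z).
Proof.
rewrite /expC modcM modc_real ger0_norm ?expR_ge0 // /modc /= cos2Dsin2 sqrtr1 mulr1 //.
Qed.
Lemma expC_neq0 z : expC z != 0.
Proof. by rewrite -modc_gt0 modc_expC expR_gt0. Qed.
Lemma expCN z : expC (- z) = (expC z)^-1.
Proof.
apply: (mulfI (expC_neq0 z)); rewrite -expCD subrr expC0 divff ?expC_neq0 //.
Qed.
Lemma expC_real x : expC x%:C = (expR x)%:C.
Proof. by rewrite /expC /= cos0 sin0; apply: eqC; rewrite !(ReM, ImM) /=; ring. Qed.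
Lemma expC_natM (n : nat) z : expC (n%:R * z) = expC z ^+ n.
Proof.
elim: n => [|n IH]; first by rewrite mul0r expC0 expr0.
by rewrite -natr1 mulrDl mul1r expCD IH exprSr.
Qed.

End complex_exponential.

(** * Differentiation of complex-valued functions of a real variable *)

Section real_variable_calculus.
Variable R : realType.
Implicit Types (x y : R) (z d e : R[i]) (phi psi : R -> R[i]).

Definition cderiv phi x d :=
  is_derive x 1 (fun y => Re (phi y)) (Re d) /\
  is_derive x 1 (fun y => Im (phi y)) (Im d).

Lemma cderiv_cst z x : cderiv (fun=> z) x 0.
Proof. by split; apply: is_derive_cst. Qed.

Lemma cderivD phi psi x d e :
  cderiv phi x d -> cderiv psi x e -> cderiv (fun y => phi y + psi y) x (d + e).
Proof.
case=> ? ? [? ?]; split; rewrite (ReD, ImD).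
- have -> : (fun y => Re (phi y + psi y)) = (fun y => Re (phi y)) + (fun y => Re (psi y)) by apply/funext => y; rewrite ReD.
  exact: is_deriveD.
- have -> : (fun y => Im (phi y + psi y)) = (fun y => Im (phi y)) + (fun y => Im (psi y)) by apply/funext => y; rewrite ImD.
  exact: is_deriveD.
Qed.

Lemma cderivM phi psi x d e :
  cderiv phi x d -> cderiv psi x e ->
  cderiv (fun y => phi y * psi y) x (d * psi x + phi x * e).
Proof.
case=> h1 h2 [h3 h4]; split; rewrite ?ReD ?ImD ?ReM ?ImM.
- have -> : (fun y => Re (phi y * psi y)) = (fun y => Re (phi y)) * (fun y => Re (psi y)) - (fun y => Im (phi y)) * (fun y => Im (psi y)) by apply/funext => y; rewrite ReM.
  apply: is_derive_eq (is_deriveB (is_deriveM h1 h3) (is_deriveM h2 h4)) _.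
  by rewrite /GRing.scale /=; ring.
- have -> : (fun y => Im (phi y * psi y)) = (fun y => Re (phi y)) * (fun y => Im (psi y)) + (fun y => Im (phi y)) * (fun y => Re (psi y)) by apply/funext => y; rewrite ImM.
  apply: is_derive_eq (is_deriveD (is_deriveM h1 h4) (is_deriveM h2 h3)) _.
  by rewrite /GRing.scale /=; ring.
Qed.

Lemma cderivZ z phi x d : cderiv phi x d -> cderiv (fun y => z * phi y) x (z * d).
Proof.
by move=> h; have := cderivM (cderiv_cst z x) h; rewrite mul0r add0r.
Qed.

Lemma cderivB phi psi x d e :
  cderiv phi x d -> cderiv psi x e -> cderiv (fun y => phi y - psi y) x (d - e).
Proof.
move=> h /(cderivZ (-1)) k; have := cderivD h k; rewrite mulN1r.
by under eq_fun do rewrite mulN1r.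
Qed.

Lemma cderiv_comp phi (g : R -> R) x d b :
  cderiv phi (g x) d -> is_derive x 1 g b -> cderiv (fun y => phi (g y)) x (d * b%:C).
Proof.
case=> h k l; split; rewrite ?ReM ?ImM /= ?mulr0 ?subr0 ?addr0 ?add0r.
- exact: (@is_derive1_comp _ (fun y => Re (phi y)) g).
- exact: (@is_derive1_comp _ (fun y => Im (phi y)) g).
Qed.

Lemma cderiv_id x : cderiv (fun y => y%:C) x 1.
Proof. by split; [exact: is_derive_id | exact: is_derive_cst]. Qed.

Lemma cderiv_expC z x : cderiv (fun y => expC (z * y%:C)) x (z * expC (z * x%:C)).
Proof.
have E y : expC (z * y%:C) = (expR (Re z * y))%:C * (cos (Im z * y) +i* sin (Im z * y)).
  by rewrite /expC !(ReM, ImM) /= !mulr0 subr0 add0r.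
have dl (a : R) : is_derive x 1 (fun y => a * y) a.
  by apply: is_derive_eq; rewrite /GRing.scale /= mulr1.
rewrite E; under eq_fun do rewrite E.
have h1 := @is_derive1_comp _ expR _ x _ _ (is_derive_expR _) (dl (Re z)).
have h2 := @is_derive1_comp _ cos _ x _ _ (is_derive_cos _) (dl (Im z)).
have h3 := @is_derive1_comp _ sin _ x _ _ (is_derive_sin _) (dl (Im z)).
have k1 : cderiv (fun y => (expR (Re z * y))%:C) x (expR (Re z * x) * Re z)%:C.
  by split; [exact: h1 | exact: is_derive_cst].
have k2 : cderiv (fun y => (cos (Im z * y) +i* sin (Im z * y))) x
   ((- sin (Im z * x) * Im z) +i* (cos (Im z * x) * Im z)).
  by split; [exact: h2 | exact: h3].
have := cderivM k1 k2; congr cderiv; apply: eqC; rewrite !(ReD, ImD, ReM, ImM) /=; ring.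
Qed.

(** The mean value theorem, false for complex values, is applied to the real and the imaginary part
    separately; hence the factor 2. *)
Lemma cderiv_le phi (dphi : R -> R[i]) (a b K : R) : a <= b ->
  (forall y, a <= y <= b -> cderiv phi y (dphi y)) ->
  (forall y, a <= y <= b -> modc (dphi y) <= K) ->
  modc (phi b - phi a) <= 2 * K * (b - a).
Proof.
rewrite le_eqVlt => /predU1P[->|ab] hd hK.
  by rewrite !subrr modc0 mulr0.
have sub y : y \in `]a, b[ -> a <= y <= b.
  by rewrite in_itv /= => /andP[/ltW-> /ltW->].
have key (g dg : R -> R) : (forall y, a <= y <= b -> is_derive y 1 g (dg y)) ->
    (forall y, a <= y <= b -> `|dg y| <= K) -> `|g b - g a| <= K * (b - a).
  move=> hg hK'.
  have cg : {within `[a, b], continuous g}.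
    apply: derivable_within_continuous => y; rewrite in_itv /= => yab.
    by have [] := hg y yab.
  have [c cab ->] := MVT ab (fun y yab => hg y (sub _ yab)) cg.
  have ba : 0 <= b - a by rewrite subr_ge0 ltW.
  by rewrite normrM (ger0_norm ba); apply: ler_wpM2r => //; exact/hK'/sub.
have -> : 2 * K * (b - a) = K * (b - a) + K * (b - a) by ring.
apply: le_trans (modc_ReIm _) _; rewrite ReD ReN ImD ImN; apply: lerD.
- apply: (key (fun y => Re (phi y)) (fun y => Re (dphi y))) => y yab.
    by have [] := hd y yab.
  exact: le_trans (modc_Re _) (hK _ yab).
- apply: (key (fun y => Im (phi y)) (fun y => Im (dphi y))) => y yab.
    by have [] := hd y yab.
  exact: le_trans (modc_Im _) (hK _ yab).
Qed.

End real_variable_calculus.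

(** * Iterated differences of the functions x^(-s) H(ln x) *)

Section differences.
Variables (R : realType) (f : nat).
Implicit Types (x y K : R) (s h : R[i]) (phi : R -> R[i]).

Definition diffR phi x : R[i] := phi x - phi (x + f%:R).

(** One difference costs one derivative and a factor [2 f], by the mean value inequality on
    [[y, y + f]]. The induction replaces the family [D k] by [diffR (D k)], again a family of
    successive derivatives. *)
Lemma iter_diffR_le m (D : nat -> R -> R[i]) x K :
  (forall k y, x <= y -> cderiv (D k) y (D k.+1 y)) ->
  (forall y, x <= y -> modc (D m y) <= K) ->
  modc (iter m diffR (D 0%N) x) <= (2 * f%:R) ^+ m * K.
Proof.
elim: m D K => [|m IH] D K hD hK /=; first by rewrite mul1r hK.
rewrite -/(iter m.+1 diffR (D 0%N) x) iterSr exprSr -mulrA.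
have fp : (0 : R) <= f%:R by [].
apply: (IH (fun k => diffR (D k))) => [k y xy|y xy].
- rewrite /diffR; apply: cderivB; first exact: hD.
  have := @cderiv_comp _ (D k) (fun y => y + f%:R) y (D k.+1 (y + f%:R)) 1.
  rewrite mulr1; apply; first by apply: hD; lra.
  by apply: is_derive_eq (is_deriveD (is_derive_id _ _) (is_derive_cst _ _ _)) _; rewrite addr0.
- rewrite /diffR modc_distC.
  have -> : 2 * f%:R * K = 2 * K * (y + f%:R - y) by ring.
  apply: (cderiv_le (dphi := D m.+1)); first lra.
    by move=> z /andP[yz _]; apply: hD; lra.
  by move=> z /andP[yz _]; apply: hK; lra.
Qed.

(* [H k] is the k-th derivative of [H 0]; the bound [e^(2 y)] becomes [x^2] at
   [y = ln x], which costs only two extra differences. *)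
Definition deriv_family (H : nat -> R -> R[i]) (K : R) :=
  (forall k y, cderiv (H k) y (H k.+1 y)) /\
  (forall k y, 0 <= y -> modc (H k y) <= K * expR (2 * y)).

(* [twist s H m] is chosen so that the m-th derivative of [x^(-s) H_0(ln x)] is
   [x^(-s-m) (twist s H m)_0(ln x)]. *)
Fixpoint twist s (H : nat -> R -> R[i]) m : nat -> R -> R[i] :=
  if m is m'.+1 then
    fun k y => twist s H m' k.+1 y - (s + m'%:R) * twist s H m' k y
  else H.

(** Each twist adds a derivative to a multiple by [s + m'], so the bound grows by a factor of at
    most [1 + |s| + m]. *)
Lemma twist_family s H K m : 0 <= K -> deriv_family H K ->
  deriv_family (twist s H m) (K * (1 + modc s + m%:R) ^+ m).
Proof.
move=> K0 hH.
(* The base of the power is frozen at [m] while the induction runs over [n <= m]. *)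
suff h n : (n <= m)%N -> deriv_family (twist s H n) (K * (1 + modc s + m%:R) ^+ n) by exact: h.
elim: n => [|n IH] nm; first by rewrite mulr1.
have [h1 h2] := IH (ltnW nm); split => k y /=.
  by apply: cderivB => //; apply: cderivZ.
move=> y0; apply: le_trans (modcB _ _) _; rewrite modcM.
set B : R := (_ * _ ^+ n) in h2.
have B0 : 0 <= B by rewrite mulr_ge0 ?exprn_ge0 // !addr_ge0 ?modc_ge0.
have -> : K * (1 + modc s + m%:R) ^+ n.+1 * expR (2 * y) =
  B * expR (2 * y) + (modc s + m%:R) * (B * expR (2 * y)) by rewrite /B exprS; ring.
apply: lerD; first exact: h2.
apply: ler_pM; rewrite ?modc_ge0 ?h2 //.
apply: le_trans (modcD _ _) _; rewrite modc_nat lerD2l ler_nat ltnW //.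
Qed.

Lemma expC_ln_natE (n : nat) x : 0 < x -> expC (- n%:R * (ln x)%:C) = (x ^- n)%:C.
Proof.
move=> x0; rewrite mulNr -mulrN -rmorphN expC_natM expC_real expRN lnK //.
by rewrite -rmorphXn exprVn.
Qed.

Lemma twist_deriv s H K m x : 0 <= K -> deriv_family H K -> 0 < x ->
  cderiv (fun y => expC (- (s + m%:R) * (ln y)%:C) * twist s H m 0 (ln y)) x
    (expC (- (s + m.+1%:R) * (ln x)%:C) * twist s H m.+1 0 (ln x)).
Proof.
move=> K0 hH x0; have [h1 _] := twist_family s m K0 hH.
have dln := is_derive1_ln x0.
have a1 := cderiv_comp (cderiv_expC (- (s + m%:R)) (ln x)) dln.
have a2 := cderiv_comp (h1 0%N (ln x)) dln.
have := cderivM a1 a2; congr cderiv => /=.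
have -> : - (s + m.+1%:R) * (ln x)%:C = - (s + m%:R) * (ln x)%:C + - 1%:R * (ln x)%:C.
  by rewrite -natr1; ring.
by rewrite expCD expC_ln_natE // expr1; ring.
Qed.

(** The m-th derivative is [y^(-s-m)] times a twisted function of size at most a constant times
    [y^2]. The exponent [2 - Re s - m] is at most [- r], and y^(-r) decreases on [[x, oo)]. *)
Lemma iter_diffR_pow_le s H K m r x : 0 <= K -> deriv_family H K -> 1 <= x ->
  2 - Re s - m%:R <= - r%:R ->
  modc (iter m diffR (fun y => expC (- s * (ln y)%:C) * H 0%N (ln y)) x) <=
    K * ((2 * f%:R) ^+ m * (1 + modc s + m%:R) ^+ m) / x ^+ r.
Proof.
move=> K0 hH x1 hm.
pose D m y := expC (- (s + m%:R) * (ln y)%:C) * twist s H m 0 (ln y).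
have -> : (fun y => expC (- s * (ln y)%:C) * H 0%N (ln y)) = D 0%N.
  by rewrite /D addr0.
have -> : K * ((2 * f%:R) ^+ m * (1 + modc s + m%:R) ^+ m) / x ^+ r =
   (2 * f%:R) ^+ m * (K * (1 + modc s + m%:R) ^+ m / x ^+ r) by ring.
apply: iter_diffR_le => [k y xy|y xy].
  by apply: twist_deriv hH _ => //; lra.
have y0 : 0 < y by lra.
have ly0 : 0 <= ln y by rewrite ln_ge0 //; lra.
have [_ h2] := twist_family s m K0 hH.
rewrite /D modcM modc_expC.
apply: le_trans (ler_wpM2l (expR_ge0 _) (h2 0%N _ ly0)) _.
rewrite mulrCA; apply: ler_wpM2l.
  by rewrite mulr_ge0 ?exprn_ge0 // !addr_ge0 ?modc_ge0.
rewrite -expRD.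
apply: (@le_trans _ _ (expR (- (r%:R * ln y)))).
  rewrite ler_expR ReM /= mulr0 subr0 ReN ReD.
  have -> : Re (m%:R : R[i]) = m%:R by rewrite -(rmorph_nat (real_complex R)).
  have := ler_wpM2r ly0 hm; nra.
rewrite expRN expRM_natl lnK ?posrE // lef_pV2 ?posrE ?exprn_gt0 //; last lra.
by apply: lerXn2r; rewrite ?nnegrE //; lra.
Qed.

(** This family stands for [N^(-s)] itself. *)
Lemma family1 : deriv_family (fun k y => (k == 0%N)%:R) 1.
Proof.
split=> k y; first by case: k => [|k]; apply: cderiv_cst.
move=> y0; rewrite modc_nat mul1r; apply: le_trans (expR_ge1Dx _).
by case: eqP => _ /=; lra.
Qed.

(** At [y = ln N] this family yields [N^(-s) ln N], the s-derivative of [N^(-s)] up to sign. *)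
Lemma family_id :
  deriv_family (fun k y => if k is k'.+1 then (k' == 0%N)%:R else y%:C) 1.
Proof.
split=> [[|k] y|[|k] y y0]; first exact: cderiv_id.
- by case: k => [|k]; apply: cderiv_cst.
- by rewrite modc_real ger0_norm // mul1r; apply: le_trans (expR_ge1Dx _); lra.
- by have [_ /(_ k y y0)] := family1.
Qed.

(* The family of derivatives of [y |-> e^(- h y) - 1 + h y], the second order
   remainder in [h] of [e^(- h y)]. *)
Definition exp_remainder h k y : R[i] :=
  match k with
  | 0%N => expC (- h * y%:C) - 1 + h * y%:C
  | 1%N => - h * expC (- h * y%:C) + h
  | _ => (- h) ^+ k * expC (- h * y%:C)
  end.

(** From the second derivative on, the bound [|h|^2 e^y] is direct. The first derivative and the
    remainder vanish at 0, so two uses of the mean value inequality on [[0, y]] give the lower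
    orders at the cost of powers of [y]. *)
Lemma family_exp_remainder h : modc h <= 1 ->
  deriv_family (exp_remainder h) (8 * modc h ^+ 2).
Proof.
move=> h1; have h0 := modc_ge0 h.
have dE k y : cderiv (exp_remainder h k) y (exp_remainder h k.+1 y).
  have e := cderiv_expC (- h) y.
  case: k => [|[|k]] /=.
  - have := cderivD (cderivB e (cderiv_cst 1 y)) (cderivZ h (cderiv_id y)).
    by rewrite subr0 mulr1.
  - have := cderivD (cderivZ (- h) e) (cderiv_cst h y).
    by rewrite addr0 expr2 mulrA.
  - by have := cderivZ ((- h) ^+ k.+2) e; rewrite mulrA -exprSr.
have bexp y : 0 <= y -> modc (expC (- h * y%:C)) <= expR y.
  move=> y0; rewrite modc_expC ler_expR ReM /= mulr0 subr0 ReN.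
  have := modc_Re h; have := ler_norm (- Re h); rewrite normrN; nra.
have b2 k y : 0 <= y -> modc (exp_remainder h k.+2 y) <= modc h ^+ 2 * expR y.
  move=> y0; rewrite /= modcM modcX modcN; apply: ler_pM; rewrite ?modc_ge0 ?exprn_ge0 ?bexp//.
  by rewrite -addn2 exprD ler_piMl ?exprn_ge0 // exprn_ile1.
have b1 y : 0 <= y -> modc (exp_remainder h 1 y) <= 2 * (modc h ^+ 2 * expR y) * y.
  move=> y0; have := @cderiv_le _ (exp_remainder h 1) (exp_remainder h 2) 0 y
    (modc h ^+ 2 * expR y) y0.
  rewrite [X in _ - X](_ : _ = 0) ?subr0; last by rewrite /= mulr0 expC0; ring.
  apply=> [z _|z /andP[z0 zy]]; first exact: dE.
  apply: le_trans (b2 0%N z z0) _; apply: ler_wpM2l; rewrite ?exprn_ge0 // ler_expR //.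
have b0 y : 0 <= y -> modc (exp_remainder h 0 y) <= 2 * (2 * (modc h ^+ 2 * expR y) * y) * y.
  move=> y0; have := @cderiv_le _ (exp_remainder h 0) (exp_remainder h 1) 0 y
    (2 * (modc h ^+ 2 * expR y) * y) y0.
  rewrite [X in _ - X](_ : _ = 0) ?subr0; last by rewrite /= mulr0 expC0; ring.
  apply=> [z _|z /andP[z0 zy]]; first exact: dE.
  apply: le_trans (b1 z z0) _; apply: ler_pM => //.
    by rewrite !mulr_ge0 ?expR_ge0 ?exprn_ge0.
  by apply: ler_wpM2l => //; apply: ler_wpM2l; rewrite ?exprn_ge0 // ler_expR.
split=> // k y y0.
have e1 := expR_ge1Dx y.
(* Hence [4 y^2 <= 8 e^y], which is where the constant 8 comes from. *)
have e2 : 1 + y ^+ 2 / 2 <= expR y by have := expR_ge1Dxn 1 y0.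
have -> : expR (2 * y) = expR y * expR y by rewrite -expRD; congr expR; ring.
have q0 : 0 <= modc h ^+ 2 * expR y by rewrite mulr_ge0 ?expR_ge0 ?exprn_ge0.
case: k => [|[|k]].
- apply: le_trans (b0 y y0) _.
  have -> : 2 * (2 * (modc h ^+ 2 * expR y) * y) * y = modc h ^+ 2 * expR y * (4 * y ^+ 2) by ring.
  have -> : 8 * modc h ^+ 2 * (expR y * expR y) = modc h ^+ 2 * expR y * (8 * expR y) by ring.
  by apply: ler_wpM2l => //; lra.
- apply: le_trans (b1 y y0) _.
  have -> : 2 * (modc h ^+ 2 * expR y) * y = modc h ^+ 2 * expR y * (2 * y) by ring.
  have -> : 8 * modc h ^+ 2 * (expR y * expR y) = modc h ^+ 2 * expR y * (8 * expR y) by ring.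
  by apply: ler_wpM2l => //; lra.
- apply: le_trans (b2 k y y0) _.
  have -> : 8 * modc h ^+ 2 * (expR y * expR y) = modc h ^+ 2 * expR y * (8 * expR y) by ring.
  by rewrite -[leLHS]mulr1; apply: ler_wpM2l => //; lra.
Qed.

End differences.

(** * Terms of the Hasse series and their decay *)

Section hasse.
Variables (R : realType) (f : nat).
Implicit Types (phi psi : nat -> R[i]) (s : R[i]) (j m v A : nat).

Definition diffN phi (N : nat) : R[i] := phi N - phi (N + f)%N.

Lemma iter_diffN_nat m (phi : R -> R[i]) N :
  iter m (diffN) (fun k => phi k%:R) N = iter m (diffR f) phi N%:R.
Proof.
elim: m phi => [//|m IH] phi; rewrite !iterSr -IH; congr (iter m _ _ _).
by apply/funext => k; rewrite /diffN /diffR natrD.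
Qed.

Lemma iter_diffNE j phi N :
  iter j diffN phi N = \sum_(i < j.+1) (-1) ^+ i * 'C(j, i)%:R * phi (N + i * f)%N.
Proof.
elim: j N => [|j IH] N.
  by rewrite big_ord1 /= expr0 bin0 !mul1r mul0n addn0.
rewrite iterS /diffN !IH [RHS]big_ord_recl [X in X - _ = _]big_ord_recl /= !bin0 !expr0 !mul0n !addn0.
rewrite -addrA; congr (_ + _).
under [in RHS]eq_bigr => i _ do rewrite /bump /= binS natrD mulrDr mulrDl.
rewrite big_split /=; congr (_ + _).
  rewrite [RHS]big_ord_recr /= bin_small // mulr0 mul0r addr0.
  by apply: eq_bigr => i _.
rewrite -sumrN; apply: eq_bigr => i _.
have -> : (N + (1 + i) * f = N + f + i * f)%N by lia.
by rewrite exprD expr1; ring.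
Qed.

Lemma modc_iter_diffN j phi N :
  modc (iter j diffN phi N) <= \sum_(i < j.+1) 'C(j, i)%:R * modc (phi (N + i * f)%N).
Proof.
rewrite iter_diffNE; apply: le_trans (modc_sum _ _ _) _.
apply: ler_sum => i _; rewrite !modcM modcX modcN modc1 expr1n mul1r modc_nat //.
Qed.

(** Each summand equals [C(j + r, i + r) j! / (j + r)!], and these binomials are part of a row of
    sum [2^(j + r)]. This is the gain of order [j^(-r)] from binomial averaging. *)
Lemma sum_bin_ratio_le j r :
  \sum_(i < j.+1) ('C(j, i)%:R * (i`!%:R / (i + r)`!%:R)) <=
    2 ^+ (j + r) * (j`!%:R / (j + r)`!%:R) :> R.
Proof.
have E (i : 'I_j.+1) : 'C(j, i)%:R * (i`!%:R / (i + r)`!%:R) =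
    'C(j + r, i + r)%:R * (j`!%:R / (j + r)`!%:R) :> R.
  have ij : (i <= j)%N by rewrite -ltnS.
  have h1 := bin_fact ij.
  have h2 : ('C(j + r, i + r) * ((i + r)`! * (j - i)`!) = (j + r)`!)%N.
    by rewrite -(bin_fact (leq_add ij (leqnn r))) subnDr.
  have p n : n`!%:R != 0 :> R by rewrite pnatr_eq0 -lt0n fact_gt0.
  rewrite -h1 -h2 !natrM; field.
  by rewrite !p /= pnatr_eq0 -lt0n bin_gt0 leq_add2r.
under eq_bigr => i _ do rewrite E.
rewrite -mulr_suml; apply: ler_wpM2r; first by rewrite divr_ge0.
rewrite -natr_sum -natrX ler_nat.
have -> : (2 ^ (j + r) = \sum_(i < (r + j).+1) 'C(j + r, i))%N.
  rewrite -[2%N]/(1 + 1)%N Pascal addnC [(r + j)%N]addnC.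
  by apply: eq_bigr => i _; rewrite !exp1n !muln1.
rewrite -addnS big_split_ord /=.
rewrite (eq_bigr (fun i : 'I_j.+1 => 'C(j + r, r + i))) ?leq_addl // => i _.
by rewrite [(i + r)%N]addnC.
Qed.

(** This bound and the next compare [(j + 1)...(j + r)] with [(j + 1)^r], so that power decay can be
    traded for reciprocals of rising products and back. *)
Lemma fact_ratio_ge j r : ((j.+1) ^ r * j`! <= (j + r)`!)%N.
Proof.
elim: r => [|r IH]; first by rewrite mul1n addn0.
rewrite addnS factS expnS -mulnA leq_mul //; lia.
Qed.

Lemma fact_ratio_le j r : ((j + r)`! <= r`! * j.+1 ^ r * j`!)%N.
Proof.
elim: r => [|r IH]; first by rewrite addn0 fact0 expn0 !mul1n.
rewrite addnS !factS expnS.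
have -> : (r.+1 * r`! * (j.+1 * j.+1 ^ r) * j`! = (r.+1 * j.+1) * (r`! * j.+1 ^ r * j`!))%N by lia.
by rewrite leq_mul //; nia.
Qed.

Lemma bin_le_expn n k : ('C(n, k) <= n ^ k)%N.
Proof.
apply: (@leq_trans (n ^_ k)); first by rewrite -bin_ffact leq_pmulr // fact_gt0.
elim: k n => [//|k IH] [|n]; first by rewrite ffact0n.
rewrite ffactnS expnS leq_mul //= (leq_trans (IH _)) //; case: (k) => [//|k']; rewrite leq_exp2r //.
Qed.

(** With [w = v.+1], this is the j-th term of [(1 - D/2)^(-w) = 2^w (1 + E)^(-w)], so the factor
    [2^w] of the L-series is already included. *)
Definition hasse_term v phi A j : R[i] :=
  ('C(j + v, v)%:R / 2 ^+ j) * iter j diffN phi A.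

(** Of the [m + j] differences, [m] provide decay of order [v + 2] and the other [j] are expanded as
    a binomial average, which carries this decay over to [j]. The coefficient [C(m + j + v, v)]
    costs [j^v], leaving [j^(-2)]. *)
Lemma hasse_term_tail_le v phi A m j (K : R) : 0 <= K ->
  (forall i, modc (iter m diffN phi (A + i * f)%N) <= K / i.+1%:R ^+ (v + 2)) ->
  modc (hasse_term v phi A (m + j)) <=
    K * (((m + v).+1 ^ v * (v + 2)`! * 2 ^ (v + 2)))%:R / j.+1%:R ^+ 2.
Proof.
move=> K0 hK; set r := (v + 2)%N in hK *.
have jp (n : nat) : (0 : R) < n.+1%:R by [].
have fp (n : nat) : (0 : R) < n`!%:R by rewrite ltr0n fact_gt0.
have p2 n : (0 : R) < 2 ^+ n by rewrite exprn_gt0.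
have b1 : modc (iter (m + j) diffN phi A) <= K * r`!%:R * (2 ^+ (j + r) / j.+1%:R ^+ r).
  rewrite addnC iterD; apply: le_trans (modc_iter_diffN _ _ _) _.
  apply: (@le_trans _ _ (\sum_(i < j.+1) K * r`!%:R * ('C(j, i)%:R * (i`!%:R / (i + r)`!%:R)))).
    apply: ler_sum => i _; rewrite mulrCA; apply: ler_wpM2l => //.
    apply: le_trans (hK _) _; rewrite -mulrA; apply: ler_wpM2l => //.
    rewrite mulrA ler_pdivlMr // mulrC ler_pdivrMr ?exprn_gt0 //.
    by rewrite -natrX -!natrM ler_nat (leq_trans (fact_ratio_le _ _)) //; lia.
  rewrite -mulr_sumr; apply: ler_wpM2l; first by rewrite mulr_ge0.
  apply: le_trans (sum_bin_ratio_le _ _) _; apply: ler_wpM2l; first exact: ltW.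
  rewrite ler_pdivrMr // mulrC ler_pdivlMr ?exprn_gt0 //.
  by rewrite -natrX -natrM ler_nat mulnC fact_ratio_ge.
rewrite /hasse_term !modcM modcV modcX !modc_nat.
have b2 : 'C(m + j + v, v)%:R <= ((m + v).+1 ^ v)%:R * j.+1%:R ^+ v :> R.
  rewrite -natrX -natrM ler_nat -expnMn; apply: leq_trans (bin_le_expn _ _) _.
  case: (v) => [//|v']; rewrite leq_exp2r //; nia.
have b3 : (2 ^+ (m + j))^-1 <= (2 ^+ j)^-1 :> R.
  by rewrite lef_pV2 ?posrE // ler_eXn2l ?ltr1n // leq_addl.
apply: (@le_trans _ _ (((m + v).+1 ^ v)%:R * j.+1%:R ^+ v * (2 ^+ j)^-1 * (K * r`!%:R * (2 ^+ (j + r) / j.+1%:R ^+ r)))).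
  apply: ler_pM => //; rewrite ?modc_ge0 // ?divr_ge0 //.
  by apply: ler_pM => //; rewrite invr_ge0 ltW.
rewrite [leLHS](_ : _ = K * ((m + v).+1 ^ v * r`! * 2 ^ r)%:R / j.+1%:R ^+ 2) //.
 rewrite !natrM [(2 ^ r)%:R]natrX !exprD.
have := jp j; move: (j.+1%:R) => x x0.
have := p2 j; move: (2 ^+ j) => y y0.
have := exprn_gt0 v x0; move: (x ^+ v) => z z0.
by field; rewrite !lt0r_neq0.
Qed.

(** One constant serves every derivative family, linearly in [K]; it is used for the convergence,
    for the s-derivative and for the remainder. The tail bound covers [j >= m], a crude estimate the
    finitely many other terms. *)
Lemma hasse_term_le v s A : (0 < A)%N -> (0 < f)%N ->
  exists2 C : R, 0 <= C & forall H (K : R), 0 <= K -> deriv_family H K -> forall j,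
    modc (hasse_term v
      (fun N => expC (- s * (ln N%:R)%:C) * H 0%N (ln N%:R)) A j) <=
    K * (C / j.+1%:R ^+ 2).
Proof.
move=> A0 f0.
(* This many differences turn the growth [x^(2 - Re s)] into the decay of order [v + 2] that the
   tail bound requires. *)
have [m hm] : exists m, 2 - Re s - m%:R <= - (v + 2)%:R.
  have := archi_boundP (normr_ge0 (v%:R + 4 - Re s)).
  set m := Num.bound _ => hb; exists m.
  by have := ler_norm (v%:R + 4 - Re s); rewrite natrD; lra.
pose C1 : R := (2 * f%:R) ^+ m * (1 + modc s + m%:R) ^+ m.
have C10 : 0 <= C1 by rewrite mulr_ge0 ?exprn_ge0 // ?mulr_ge0 // !addr_ge0 ?modc_ge0.
pose Q : R := (((m + v).+1 ^ v * (v + 2)`! * 2 ^ (v + 2)))%:R.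
(* The crude bound for [j < m]: the difference is expanded and each [phi N] is estimated by
   [K N^(2 - Re s)], without cancellation. *)
pose b j : R := 'C(j + v, v)%:R / 2 ^+ j *
  \sum_(i < j.+1) 'C(j, i)%:R * expR ((2 - Re s) * ln (A + i * f)%:R).
have b0 j : 0 <= b j.
  by rewrite mulr_ge0 ?divr_ge0 ?exprn_ge0 // sumr_ge0 // => i _; rewrite mulr_ge0 ?expR_ge0.
pose S := \sum_(j < m) b j.
have S0 : 0 <= S by rewrite sumr_ge0.
have Q0 : 0 <= Q by rewrite /Q.
exists ((C1 * Q + S) * m.+1%:R ^+ 2).
  exact: mulr_ge0 (addr_ge0 (mulr_ge0 C10 Q0) S0) (exprn_ge0 _ (ler0n _ _)).
move=> H K K0 hH j; set phi := (fun N : nat => _).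
have jp (n : nat) : (0 : R) < n.+1%:R by [].
case: (ltnP j m) => jm.
- have h1 : modc (hasse_term v phi A j) <= K * b j.
    rewrite /hasse_term !modcM modcV modcX !modc_nat /b mulrCA.
    apply: ler_wpM2l; first by rewrite divr_ge0 ?exprn_ge0.
    apply: le_trans (modc_iter_diffN _ _ _) _; rewrite mulr_sumr.
    apply: ler_sum => i _; rewrite mulrCA; apply: ler_wpM2l => //.
    have [_ h2] := hH; rewrite /phi modcM modc_expC ReM /= mulr0 subr0 ReN.
    have l0 : 0 <= ln (A + i * f)%:R :> R by rewrite ln_ge0 // ler1n; lia.
    apply: le_trans (ler_wpM2l (expR_ge0 _) (h2 0%N _ l0)) _.
    by rewrite mulrCA -expRD; apply: ler_wpM2l => //; rewrite ler_expR; lra.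
  apply: le_trans h1 _; apply: ler_wpM2l => //.
  rewrite ler_pdivlMr ?exprn_gt0 //; apply: ler_pM => //; rewrite ?exprn_ge0 //.
    apply: (@le_trans _ _ S); last by rewrite lerDr mulr_ge0.
    by rewrite /S (bigD1 (Ordinal jm)) //= lerDl sumr_ge0.
  by rewrite lerXn2r ?nnegrE // ler_nat; lia.
- have hK i : modc (iter m diffN phi (A + i * f)%N) <= K * C1 / i.+1%:R ^+ (v + 2).
    rewrite /phi (iter_diffN_nat m (fun y => expC (- s * (ln y)%:C) * H 0%N (ln y))).
    have A1 : (1 : R) <= (A + i * f)%:R by rewrite ler1n; lia.
    apply: le_trans (iter_diffR_pow_le f K0 hH A1 hm) _.
    rewrite -/C1; apply: ler_wpM2l; first by rewrite mulr_ge0.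
    rewrite lef_pV2 ?posrE ?exprn_gt0 //; last lra.
    by rewrite lerXn2r ?nnegrE // ler_nat; nia.
  have := hasse_term_tail_le (j - m) (mulr_ge0 K0 C10) hK.
  rewrite subnKC // -/Q => /le_trans; apply.
  have CQ : 0 <= C1 * Q by exact: mulr_ge0.
  clearbody C1 Q S.
  have -> : K * C1 * Q / (j - m).+1%:R ^+ 2 = K * (C1 * Q / (j - m).+1%:R ^+ 2) by rewrite !mulrA.
  apply: ler_wpM2l => //.
  (* The shift of the index is absorbed by [j + 1 <= (m + 1)(j - m + 1)]. *)
  rewrite ler_pdivlMr ?exprn_gt0 // mulrAC ler_pdivrMr ?exprn_gt0 //.
  rewrite -[leRHS]mulrA -exprMn; apply: ler_pM => //; rewrite ?exprn_ge0 //.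
    by rewrite lerDl.
  by rewrite -natrM lerXn2r ?nnegrE // ler_nat; nia.
Qed.

End hasse.

(** * Convergence and termwise differentiation of complex series *)

Section complex_series.
Variable R : realType.

Lemma cvgCP (T : Type) (F : set_system T) (FF : Filter F) (u : T -> R[i]) (l : R[i]) :
  (u : T -> R[i]^o) @ F --> (l : R[i]^o) <->
  forall e : R, 0 < e -> \forall x \near F, modc (u x - l) < e.
Proof.
split=> [/cvgrPdist_lt h e e0|h].
  have e0' : 0 < e%:C by rewrite ltcR.
  by have := h _ e0'; apply: filterS => x; rewrite normE ltcR modc_distC.
apply/cvgrPdist_lt => e e0.
(* A positive element of [R[i]] has zero imaginary part. *)
have [e' e'0 ->] : exists2 e', 0 < e' & e = e'%:C.
  by move: e0; rewrite ltcE /= => /andP[/eqP ei er]; exists (Re e) => //; apply: eqC.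
by have := h _ e'0; apply: filterS => x; rewrite normE ltcR modc_distC.
Qed.

Definition cvgc (u : nat -> R[i]) (l : R[i]) : Prop :=
  (u : nat -> R[i]^o) @ \oo --> (l : R[i]^o).

Lemma lim_modc_le (u : nat -> R[i]) (l : R[i]) (B : R) :
  cvgc u l ->
  (\forall n \near \oo, modc (u n) <= B) -> modc l <= B.
Proof.
move=> /cvgCP h hB; apply/ler_addgt0Pr => e e0.
near (\oo : set_system nat) => n.
have h1 : modc (u n - l) < e by near: n; exact: h.
have h2 : modc (u n) <= B by near: n.
have := modcB (u n) (u n - l); rewrite opprB addrCA subrr addr0 => h3.
by apply: le_trans h3 _; apply: lerD => //; exact: ltW.
Unshelve. all: by end_near. Qed.

Lemma cvg_ReIm (u : nat -> R[i]) (l : R[i]) :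
  (fun n => Re (u n)) @ \oo --> Re l -> (fun n => Im (u n)) @ \oo --> Im l ->
  cvgc u l.
Proof.
move=> /cvgrPdist_lt h1 /cvgrPdist_lt h2; apply/cvgCP => e e0.
have e20 : 0 < e / 2 by lra.
have := h2 _ e20; have := h1 _ e20; apply: filterS2 => n k1 k2.
apply: le_lt_trans (modc_ReIm _) _; rewrite ReD ImD ReN ImN.
by rewrite (distrC _ (Re l)) (distrC _ (Im l)); lra.
Qed.

Lemma is_cvg_series_modc (u : nat -> R[i]) (M : nat -> R) :
  (forall j, modc (u j) <= M j) -> cvgn (series M) ->
  exists l, cvgc (series u) l.
Proof.
move=> hM cM.
have key (p : R[i] -> R) : (forall z, `|p z| <= modc z) -> cvgn (series (fun j => p (u j))).
  move=> hp; apply: normed_cvg; apply: series_le_cvg cM => n //=.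
    exact: le_trans (modc_ge0 _) (hM n).
  exact: le_trans (hp _) (hM n).
have cRe := key _ (@modc_Re R); have cIm := key _ (@modc_Im R).
pose l := limn (series (fun j => Re (u j))) +i* limn (series (fun j => Im (u j))).
exists l; apply: cvg_ReIm => /=.
- rewrite [X in X @ _ --> _](_ : _ = series (fun j => Re (u j))) //.
  by apply/funext => n; rewrite /series /= (big_morph _ (@ReD R) (erefl _)).
- rewrite [X in X @ _ --> _](_ : _ = series (fun j => Im (u j))) //.
  by apply/funext => n; rewrite /series /= (big_morph _ (@ImD R) (erefl _)).
Qed.

Lemma series_modc_le (u : nat -> R[i]) (l : R[i]) (M : nat -> R) :
  (forall j, modc (u j) <= M j) -> cvgn (series M) ->
  cvgc (series u) l -> modc l <= limn (series M).
Proof.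
move=> hM cM cu; apply: lim_modc_le cu _; near=> n.
apply: le_trans (modc_sum _ _ _) _.
apply: (@le_trans _ _ (series M n)); first by apply: ler_sum.
have inc : nondecreasing_seq (series M).
  apply/nondecreasing_seqP => k.
  by rewrite /series /= big_nat_recr //= lerDl (le_trans (modc_ge0 _) (hM k)).
exact: nondecreasing_cvgn_le.
Unshelve. all: by end_near. Qed.

Lemma cvgcD (u v : nat -> R[i]) (l m : R[i]) :
  cvgc u l ->
  cvgc v m ->
  cvgc (fun n => u n + v n) (l + m).
Proof. exact: cvgD. Qed.

Lemma cvgcZ (z : R[i]) (u : nat -> R[i]) (l : R[i]) :
  cvgc u l ->
  cvgc (fun n => z * u n) (z * l).
Proof. exact: (@cvgZr _ (R[i]^o)). Qed.

Lemma cvgc_sum (I : Type) (r : seq I) (u : I -> nat -> R[i]) (l : I -> R[i]) :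
  (forall i, cvgc (u i) (l i)) ->
  cvgc (fun n => \sum_(i <- r) u i n) (\sum_(i <- r) l i).
Proof.
move=> h; elim: r => [|i r IH].
  rewrite big_nil; under eq_fun do rewrite big_nil.
  exact: cvg_cst.
rewrite big_cons; under eq_fun do rewrite big_cons.
exact: (cvgcD (h i) IH).
Qed.

Lemma cvgc_lim (T : Type) (F : set_system T) (FF : ProperFilter F) (u : T -> R[i]) (l : R[i]) :
  (u : T -> R[i]^o) @ F --> (l : R[i]^o) -> lim ((u : T -> R[i]^o) @ F) = l.
Proof. exact: cvg_lim. Qed.

(** The second order remainders [|h|^2 M_j] sum to [|h|^2 B], so the difference quotient is within
    [|h| B] of the sum [D] of the [d j]. *)
Lemma derivable_series (u : nat -> R[i] -> R[i]) (F : R[i] -> R[i])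
    (d : nat -> R[i]) (s : R[i]) (M : nat -> R) :
  cvgn (series M) ->
  (forall z, cvgc (series (u^~ z)) (F z)) ->
  (forall j, modc (d j) <= M j) ->
  (forall j h, modc h <= 1 ->
     modc (u j (s + h) - u j s - h * d j) <= modc h ^+ 2 * M j) ->
  derivable (F : R[i]^o -> R[i]^o) s 1.
Proof.
move=> cM hF hd hM.
have [D hD] := is_cvg_series_modc hd cM.
pose B : R := limn (series M).
have key h : modc h <= 1 -> modc (F (s + h) - F s - h * D) <= modc h ^+ 2 * B.
  move=> h1.
  have c := cvgcD (cvgcD (hF (s + h)) (cvgcZ (z := -1) (hF s))) (cvgcZ (z := - h) hD).
  have cM2 : cvgn (series (modc h ^+ 2 *: M)) by apply: is_cvg_seriesZ.
  have -> : modc h ^+ 2 * B = limn (series (modc h ^+ 2 *: M)).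
    by rewrite lim_seriesZ.
  apply: series_modc_le cM2 _; first by move=> j; apply: hM h1.
  rewrite mulN1r mulNr in c.
  rewrite [X in cvgc X](_ : _ = (fun n => series (u^~ (s + h)) n +
    -1 * series (u^~ s) n + - h * series d n)) //.
  by apply/funext => n; rewrite /series /= mulN1r mulNr mulr_sumr -!sumrB.
apply/cvg_ex; exists (D : R[i]^o); apply/cvgCP => e e0.
have B0 : 0 <= B.
  have := key 1; rewrite modc1 lexx => /(_ isT); rewrite expr1n [leRHS]mul1r.
  exact: le_trans (modc_ge0 _).
(* The bound 1 makes [key] applicable; [B + 1] replaces [B], which may be 0. *)
have d0 : 0 < (Num.min 1 (e / (B + 1)))%:C :> R[i].
  by rewrite ltcR lt_min ltr01 divr_gt0 //; lra.
near=> h.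
have hn0 : h != 0 by near: h; exact: nbhs_dnbhs_neq.
have : `|h| < (Num.min 1 (e / (B + 1)))%:C by near: h; exact: dnbhs0_lt.
rewrite normE ltcR lt_min => /andP[h1 h2].
have hp : 0 < modc h by rewrite modc_gt0.
have -> : h^-1 *: (F (h *: 1 + s) - F s) - D = h^-1 * (F (s + h) - F s - h * D).
  rewrite /GRing.scale /= mulr1 (addrC h) [RHS]mulrBr; congr (_ - _).
  by rewrite mulrA mulVf // mul1r.
rewrite modcM modcV mulrC ltr_pdivrMr //.
apply: le_lt_trans (key _ (ltW h1)) _.
rewrite expr2 mulrAC ltr_pM2r //.
move: h2; rewrite ltr_pdivlMr; nra.
Unshelve. all: by end_near. Qed.

Lemma is_cvg_series_inv_sqr (C : R) :
  cvgn (series (fun j : nat => C / j.+1%:R ^+ 2)).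
Proof.
rewrite (_ : (fun j : nat => _) = C *: (fun j : nat => (j.+1%:R ^+ 2)^-1)) //.
apply: is_cvg_seriesZ; apply: nondecreasing_is_cvgn.
  apply/nondecreasing_seqP => n; rewrite /series /= [leRHS]big_nat_recr //= lerDl.
  by rewrite invr_ge0 exprn_ge0.
exists 2 => _ [[|n] _ <-]; first by rewrite /series /= big_geq.
(* Telescoping: [1/(n + 2)^2 <= 1/(n + 1) - 1/(n + 2)]. *)
suff : series (fun j : nat => (j.+1%:R ^+ 2)^-1) n.+1 <= 2 - n.+1%:R^-1 :> R.
  by move=> /le_trans; apply; rewrite gerBl.
elim: n => [|n IH]; first by rewrite /series /= big_nat1 expr1n invr1; lra.
rewrite /series /= big_nat_recr //=; apply: le_trans (lerD IH (lexx _)) _.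
have n0 : (0 : R) <= n%:R by [].
rewrite -[n.+2%:R]natr1 -[n.+1%:R]natr1.
rewrite -subr_ge0 [X in 0 <= X](_ : _ = ((n%:R + 1) * (n%:R + 1 + 1) ^+ 2)^-1).
  by rewrite invr_ge0 mulr_ge0 ?exprn_ge0 //; lra.
by field; rewrite !lt0r_neq0 //; lra.
Qed.

End complex_series.

(** * The Hasse series defines an entire function *)

Section hasse_entire.
Variables (R : realType) (f : nat).

Definition powNC (s : R[i]) (N : nat) : R[i] := expC (- s * (ln N%:R)%:C).

Lemma iter_diffN_lin j (a b : R[i]) (phi psi : nat -> R[i]) A :
  iter j (diffN f) (fun N => a * phi N + b * psi N) A =
  a * iter j (diffN f) phi A + b * iter j (diffN f) psi A.
Proof.
by elim: j A => [//|j IH] A; rewrite !iterS {1 3 5}/diffN !IH; ring.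
Qed.

Lemma hasse_term_lin v j (a b : R[i]) (phi psi : nat -> R[i]) A :
  hasse_term f v (fun N => a * phi N + b * psi N) A j =
  a * hasse_term f v phi A j + b * hasse_term f v psi A j.
Proof. by rewrite /hasse_term iter_diffN_lin; ring. Qed.

(** [hasse_term_le] is used with three families: [family1] gives convergence at every [s],
    [family_id] bounds the termwise derivative, and [exp_remainder] gives the quadratic remainder
    for [derivable_series]. *)
Lemma hasse_entire v A : (0 < A)%N -> (0 < f)%N ->
  exists F : R[i] -> R[i], entire F /\
    forall s, cvgc (series (hasse_term f v (powNC s) A)) (F s).
Proof.
move=> A0 f0.
have H1 s : powNC s = (fun N => expC (- s * (ln N%:R)%:C) * 1).
  by apply/funext => N; rewrite mulr1.
have /boolp.choice[F hF] : forall s, exists l, cvgc (series (hasse_term f v (powNC s) A)) l.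
  move=> s; have [C C0 hC] := hasse_term_le (R := R) v s A0 f0.
  apply: (is_cvg_series_modc (M := fun j => C / j.+1%:R ^+ 2)); last exact: is_cvg_series_inv_sqr.
  by move=> j; have := hC _ _ ler01 (@family1 R) j; rewrite mul1r H1.
exists F; split; last exact: hF.
move=> s.
have [C C0 hC] := hasse_term_le (R := R) v s A0 f0.
pose lnN (N : nat) := expC (- s * (ln N%:R)%:C) * (ln N%:R : R)%:C.
apply: (@derivable_series _ (fun j z => hasse_term f v (powNC z) A j) F
  (fun j => (-1) * hasse_term f v lnN A j) s (fun j => (8 * C) / j.+1%:R ^+ 2)) => //.
- exact: is_cvg_series_inv_sqr.
- move=> j; rewrite modcM modcN modc1 mul1r.
  have := hC _ _ ler01 (@family_id R) j; rewrite mul1r => /le_trans; apply.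
  by rewrite ler_wpM2r ?invr_ge0 ?exprn_ge0 //; lra.
- move=> j h h1.
  have := hC _ _ (mulr_ge0 (ler0n _ 8) (exprn_ge0 2 (modc_ge0 h))) (family_exp_remainder h1) j.
  rewrite [X in X <= _ -> _](_ : _ = modc (hasse_term f v (powNC (s + h)) A j -
    hasse_term f v (powNC s) A j - h * (-1 * hasse_term f v lnN A j))).
    have -> : modc h ^+ 2 * (8 * C / j.+1%:R ^+ 2) = 8 * modc h ^+ 2 * (C / j.+1%:R ^+ 2); last by [].
    by move: (modc h ^+ 2) (j.+1%:R ^+ 2) => a b; ring.
  congr modc.
  (* Times [N^(-s)], the remainder becomes [N^(-s-h) - N^(-s) + h N^(-s) ln N], a linear combination
     to which [hasse_term_lin] applies. *)
  have -> : (fun N : nat => expC (- s * (ln N%:R)%:C) * exp_remainder h 0 (ln N%:R)) =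
    (fun N => 1 * (1 * powNC (s + h) N + (-1) * powNC s N) + h * lnN N).
    apply/funext => N; rewrite /= /powNC /lnN.
    have -> : - (s + h) * (ln N%:R)%:C = - s * (ln N%:R)%:C + - h * (ln N%:R)%:C by ring.
    by rewrite expCD; ring.
  by rewrite !hasse_term_lin; ring.
Qed.

End hasse_entire.

(** * The series of [n^(-p)] and the negative binomial weights *)

Section real_series.
Variable R : realType.

(** A discrete integral test: with [q = p - 1], the inequalities [ln (1 + x) <= x] and
    [e^x >= 1 + x] give [q (n + 1)^(-p) <= n^(-q) - (n + 1)^(-q)], which telescopes. *)
Lemma is_cvg_series_pseries (p : R) : 1 < p ->
  cvgn (series (fun n : nat => expR (- p * ln n.+1%:R))).
Proof.
move=> p1; set q := p - 1; have q0 : 0 < q by rewrite /q; lra.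
apply: nondecreasing_is_cvgn.
  apply/nondecreasing_seqP => n; rewrite /series /= [leRHS]big_nat_recr //= lerDl.
  exact: expR_ge0.
exists (1 + q^-1) => _ [[|n] _ <-].
  by rewrite /series /= big_geq // addr_ge0 // invr_ge0 ltW.
suff : series (fun n : nat => expR (- p * ln n.+1%:R)) n.+1 <=
    1 + q^-1 * (1 - expR (- q * ln n.+1%:R)).
  move=> /le_trans; apply; rewrite lerD2l -[leRHS]mulr1 ler_wpM2l ?invr_ge0 ?(ltW q0) //.
elim: n => [|n IH]; first by rewrite /series /= big_nat1 ln1 !mulr0 expR0 subrr mulr0 addr0.
rewrite /series /= big_nat_recr //=; apply: le_trans (lerD IH (lexx _)) _.
have -> : forall a b : R, 1 + q^-1 * (1 - a) + b <= 1 + q^-1 * (1 - expR (- q * ln n.+2%:R))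
   = (q * b <= a - expR (- q * ln n.+2%:R)).
  move=> a b; rewrite -addrA lerD2l -(ler_pM2l q0) mulrDr !mulrA divff ?lt0r_neq0 // !mul1r.
  by rewrite -subr_ge0 -[in RHS]subr_ge0; congr (0 <= _); ring.
have n2 : (0 : R) < n.+2%:R by [].
have n1 : (0 : R) < n.+1%:R by [].
have hl : ln n.+1%:R - ln n.+2%:R <= - n.+2%:R^-1 :> R.
  rewrite -ln_div ?posrE //.
  have -> : n.+1%:R / n.+2%:R = 1 + - n.+2%:R^-1 :> R.
    have nz := lt0r_neq0 n2; apply: (mulIf nz).
    by rewrite mulfVK // mulrBl mul1r mulVf // -[n.+2%:R]natr1 addrK.
  by apply: le_ln1Dx; rewrite ltrN2 invf_lt1 // ltr1n.
have -> : expR (- q * ln n.+1%:R) = expR (- q * ln n.+2%:R) * expR (q * (ln n.+2%:R - ln n.+1%:R)).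
  by rewrite -expRD; congr expR; ring.
have -> : expR (- p * ln n.+2%:R) = expR (- q * ln n.+2%:R) * n.+2%:R^-1 :> R.
  have -> : n.+2%:R^-1 = expR (- ln n.+2%:R) :> R by rewrite expRN lnK ?posrE.
  by rewrite -expRD; congr expR; rewrite /q; ring.
have e0 : 0 <= expR (- q * ln n.+2%:R) by exact: expR_ge0.
have := expR_ge1Dx (q * (ln n.+2%:R - ln n.+1%:R)).
have : q * n.+2%:R^-1 <= q * (ln n.+2%:R - ln n.+1%:R) by rewrite ler_pM2l // -lerN2 opprB.
move: (n.+2%:R^-1) (q * (_ - _)) (expR (q * _)) => a c b h1 h2 {hl}.
move: (expR (- q * ln n.+2%:R)) e0 => d d0.
have : d * (q * a) <= d * (b - 1).
  by apply: ler_wpM2l => //; lra.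
nra.
Qed.

(* The weight, relative to its limit, of the i-th term in the J-th partial sum of
   the Euler transform is [negbin (i + v) (J - i)], a negative binomial
   distribution function with parameter 1/2. *)
Definition negbin (n K : nat) : R := \sum_(k < K) 'C(k + n, n)%:R / 2 ^+ (k + n).+1.

Lemma negbinS n K : negbin n.+1 K.+1 = 2^-1 * negbin n.+1 K + 2^-1 * negbin n K.+1.
Proof.
have -> : negbin n.+1 K.+1 = \sum_(k < K.+1) 'C(k + n, n.+1)%:R / 2 ^+ (k + n).+2 +
   \sum_(k < K.+1) 'C(k + n, n)%:R / 2 ^+ (k + n).+2.
  by rewrite -big_split; apply: eq_bigr => k _; rewrite addnS binS natrD mulrDl.
congr (_ + _).
  rewrite big_ord_recl /= bin_small // mul0r add0r mulr_sumr; apply: eq_bigr => k _.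
  by rewrite /bump /= add1n addSnnS [2 ^+ _.+2]exprS invfM mulrCA.
by rewrite mulr_sumr; apply: eq_bigr => k _; rewrite exprS invfM mulrCA.
Qed.

Lemma negbin_nondecreasing n : nondecreasing_seq (negbin n).
Proof.
apply/nondecreasing_seqP => K; rewrite /negbin big_ord_recr /= lerDl.
by rewrite divr_ge0 ?exprn_ge0.
Qed.

Lemma negbin0E K : negbin 0 K = 1 - 2^-1 ^+ K.
Proof.
elim: K => [|K IH]; first by rewrite /negbin big_ord0 expr0 subrr.
rewrite /negbin big_ord_recr /= -/(negbin 0 K) IH bin0 addn0 mul1r -exprVn exprS.
lra.
Qed.

Lemma negbin_le1 n K : negbin n K <= 1.
Proof.
elim: n K => [|n IHn] K; first by rewrite negbin0E gerBl exprn_ge0 // invr_ge0.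
elim: K => [|K IH]; first by rewrite /negbin big_ord0.
by rewrite negbinS; have := IHn K.+1; lra.
Qed.

(** By induction on [n]: the sequence is monotone and bounded, and [negbinS] forces its limit to
    satisfy [l = l/2 + 1/2]. *)
Lemma cvg_negbin n : negbin n @ \oo --> (1 : R).
Proof.
elim: n => [|n IH].
  rewrite (_ : negbin 0 = fun K => 1 - 2^-1 ^+ K); last by apply/funext => K; rewrite negbin0E.
  rewrite -[X in _ --> X]subr0; apply: cvgB; first exact: cvg_cst.
  by apply: cvg_expr; rewrite ger0_norm ?invr_ge0 // invf_lt1 // ltr1n.
have c : cvgn (negbin n.+1).
  apply: nondecreasing_is_cvgn; first exact: negbin_nondecreasing.
  by exists 1 => _ [K _ <-]; apply: negbin_le1.
suff <- : limn (negbin n.+1) = 1 by [].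
have h1 : (fun K => negbin n.+1 K.+1) @ \oo --> limn (negbin n.+1).
  by rewrite (cvg_shiftS (negbin n.+1)).
have h2 : (fun K => negbin n.+1 K.+1) @ \oo --> 2^-1 * limn (negbin n.+1) + 2^-1 * 1.
  rewrite (_ : (fun K => _) = (fun K => 2^-1 * negbin n.+1 K + 2^-1 * negbin n K.+1)).
    apply: cvgD; apply: cvgMr => //.
    by rewrite (cvg_shiftS (negbin n)).
  by apply/funext => K; rewrite negbinS.
have : limn (negbin n.+1) = 2^-1 * limn (negbin n.+1) + 2^-1 * 1 :> R^o.
  exact: (cvg_unique _ h1 h2).
by move: (limn _ : R) => l; rewrite /R^o; lra.
Qed.

End real_series.

(** * Euler's transformation preserves absolutely convergent sums *)

Section euler_transform.
Variable R : realType.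

Lemma cvgc_unique (u : nat -> R[i]) (l l' : R[i]) : cvgc u l -> cvgc u l' -> l = l'.
Proof. by move=> h h'; rewrite -(cvgc_lim _ h) (cvgc_lim _ h'). Qed.

(** Three errors below [e/4]: the partial sum of [b] against [l], the first [I] terms, whose weights
    are close to 1, and the remaining ones, dominated by the tail of [M] since the weights lie in
    [[0, 1]]. *)
Lemma tannery (b : nat -> R[i]) (M : nat -> R) (theta : nat -> nat -> R) (l : R[i]) :
  (forall i, modc (b i) <= M i) -> cvgn (series M) ->
  (forall J i, 0 <= theta J i <= 1) ->
  (forall i, theta^~ i @ \oo --> (1 : R)) ->
  cvgc (series b) l ->
  cvgc (fun J => \sum_(i < J) b i * (theta J i)%:C) l.
Proof.
move=> bM cM th01 th1 bl.
have M0 i : 0 <= M i by exact: le_trans (modc_ge0 _) (bM i).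
apply/cvgCP => e e0.
have e4 : 0 < e / 4 by lra.
pose L := limn (series M).
have cML : series M @ \oo --> (L : R) by [].
have inc : nondecreasing_seq (series M).
  by apply/nondecreasing_seqP => k; rewrite /series /= big_nat_recr //= lerDl.
have leL n : series M n <= L by exact: nondecreasing_cvgn_le.
have [I hI] : exists I, L - series M I < e / 4.
  have /cvgrPdist_lt/(_ _ e4)[I _ /(_ I (leqnn _))] := cML.
  by move=> h; exists I; apply: le_lt_trans (ler_norm _) h.
have hfin : \forall J \near \oo, \sum_(i < I) M i * (1 - theta J i) < e / 4.
  have : (fun J => \sum_(i < I) M i * (1 - theta J i)) @ \oo --> \sum_(i < I) M i * (1 - 1).
    elim: I {hI} => [|I IH].
      by rewrite big_ord0; under eq_fun do rewrite big_ord0; apply: cvg_cst.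
    rewrite big_ord_recr /=; under eq_fun do rewrite big_ord_recr /=.
    apply: cvgD; first exact: IH.
    by apply: cvgMr; apply: cvgB; [exact: cvg_cst|exact: th1].
  rewrite big1 => [|i _]; last by rewrite subrr mulr0.
  move/cvgrPdist_lt => /(_ _ e4); apply: filterS => J; rewrite sub0r normrN.
  exact/le_lt_trans/ler_norm.
near=> J.
have hJ : modc (series b J - l) < e / 4 by near: J; move/cvgCP : bl; apply.
have h2 : \sum_(i < I) M i * (1 - theta J i) < e / 4 by near: J.
have IJ : (I <= J)%N by near: J; exact: nbhs_infty_ge.
have -> : \sum_(i < J) b i * (theta J i)%:C - l =
   (series b J - l) - \sum_(i < J) b i * (1 - theta J i)%:C.
  rewrite /series /= big_mkord addrAC; congr (_ - _); rewrite -sumrB.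
  by apply: eq_bigr => i _; rewrite rmorphB rmorph1; ring.
apply: le_lt_trans (modcB _ _) _.
have : modc (\sum_(i < J) b i * (1 - theta J i)%:C) <= \sum_(i < J) M i * (1 - theta J i).
  apply: le_trans (modc_sum _ _ _) _; apply: ler_sum => i _.
  have /andP[t0 t1] := th01 J i.
  by rewrite modcM modc_real ger0_norm ?subr_ge0 // ler_wpM2r // subr_ge0.
have : \sum_(i < J) M i * (1 - theta J i) <=
    \sum_(i < I) M i * (1 - theta J i) + (series M J - series M I).
  rewrite -!(big_mkord xpredT (fun i => M i * (1 - theta J i))) /series /=.
  rewrite (big_cat_nat (n := I)) //= [X in _ <= _ + (X - _)](big_cat_nat (n := I)) //=.
  rewrite [X in _ <= _ + X]addrAC subrr add0r lerD2l.
  apply: ler_sum => i _; have /andP[t0 t1] := th01 J i.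
  by rewrite ler_piMr // gerBl.
have := leL J; lra.
Unshelve. all: by end_near. Qed.

Variable f : nat.

(** After expanding the differences and exchanging the sums, [phi (A + i f)] has the coefficient
    [(-1)^i] times the sum over [i <= j < J] of [C(j + v, v) C(j, i) / 2^j]; putting [j = k + i]
    reveals the negative binomial weight. *)
Lemma series_hasse_termE v (phi : nat -> R[i]) A J :
  series (hasse_term f v phi A) J = 2 ^+ v.+1 * \sum_(i < J)
    ((-1) ^+ i * 'C(i + v, v)%:R * phi (A + i * f)%N) * (negbin R (i + v) (J - i))%:C.
Proof.
rewrite /series /= big_mkord.
pose t (j i : nat) : R[i] := ('C(j + v, v)%:R / 2 ^+ j) * ((-1) ^+ i * 'C(j, i)%:R * phi (A + i * f)%N).
have -> : \sum_(j < J) hasse_term f v phi A j = \sum_(j < J) \sum_(i < J) t j i.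
  apply: eq_bigr => j _; rewrite /hasse_term iter_diffNE mulr_sumr.
  rewrite (big_ord_widen J (fun i => t j i)) //= big_mkcond /=.
  apply: eq_bigr => i _; case: ifP => // /negbT; rewrite -leqNgt => ji.
  by rewrite /t ['C(j, i)]bin_small // mulr0 mul0r mulr0.
rewrite exchange_big /= mulr_sumr; apply: eq_bigr => i _.
have iJ : (i <= J)%N by exact: ltnW.
rewrite -(big_mkord xpredT (fun j => t j i)) (big_cat_nat (n := i)) //= big_nat big1 ?add0r; last first.
  by move=> j /andP[_ ji]; rewrite /t ['C(j, i)]bin_small // mulr0 mul0r mulr0.
rewrite -{1}[i : nat]add0n big_addn big_mkord /negbin rmorph_sum /= !mulr_sumr.
apply: eq_bigr => k _; rewrite /t.
(* Both sides are the multinomial coefficient [(k + i + v)! / (v! i! k!)]. *)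
have E : ('C(k + i + v, v) * 'C(k + i, i) = 'C(i + v, v) * 'C(k + (i + v), i + v))%N.
  have fp n : (0 < n`!)%N := fact_gt0 n.
  have h1 : ('C(k + i + v, v) * (v`! * (k + i)`!) = (k + i + v)`!)%N.
    by rewrite -[in RHS](@bin_fact (k + i + v) v) ?leq_addl // addnK.
  have h2 : ('C(k + i, i) * (i`! * k`!) = (k + i)`!)%N.
    by rewrite -[in RHS](@bin_fact (k + i) i) ?leq_addl // addnK.
  have h3 : ('C(i + v, v) * (v`! * i`!) = (i + v)`!)%N.
    by rewrite -[in RHS](@bin_fact (i + v) v) ?leq_addl // addnK.
  have h4 : ('C(k + (i + v), i + v) * ((i + v)`! * k`!) = (k + (i + v))`!)%N.
    by rewrite -[in RHS](@bin_fact (k + (i + v)) (i + v)) ?leq_addl // addnK.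
  have p : (0 < v`! * (i`! * k`!))%N by rewrite !muln_gt0 !fp.
  apply/eqP; rewrite -(eqn_pmul2r p); apply/eqP.
  transitivity ((k + i + v)`!); first by rewrite -h1 -h2; lia.
  by rewrite -addnA -h4 -h3; lia.
have n2 n : (2 ^+ n : R[i]) != 0 by rewrite expf_neq0 // pnatr_eq0.
have -> : ('C(k + (i + v), i + v)%:R / 2 ^+ (k + (i + v)).+1)%:C =
  'C(k + (i + v), i + v)%:R / (2 ^+ (k + i) * 2 ^+ v.+1) :> R[i].
  rewrite rmorphM /= fmorphV rmorphXn /= !rmorph_nat -exprD.
  by congr (_ / 2 ^+ _); lia.
have := congr1 (fun n => n%:R : R[i]) E; rewrite /= !natrM => E'.
transitivity ((-1) ^+ i * phi (A + i * f)%N * ('C(k + i + v, v)%:R * 'C(k + i, i)%:R) / 2 ^+ (k + i) : R[i]).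
  by ring.
by rewrite E'; field; rewrite !n2.
Qed.

(** For each [i] the weights of [series_hasse_termE] tend to 1, so [tannery] identifies the
    transformed sum. *)
Lemma euler_transform v (phi : nat -> R[i]) A (M : nat -> R) (l l' : R[i]) :
  (forall i, 'C(i + v, v)%:R * modc (phi (A + i * f)%N) <= M i) ->
  cvgn (series M) ->
  cvgc (series (hasse_term f v phi A)) l ->
  cvgc (series (fun i => (-1) ^+ i * 'C(i + v, v)%:R * phi (A + i * f)%N)) l' ->
  l = 2 ^+ v.+1 * l'.
Proof.
move=> hM cM hl hl'.
set b := (fun i => _) in hl'.
have c : cvgc (fun J => \sum_(i < J) b i * (negbin R (i + v) (J - i))%:C) l'.
  apply: (tannery (theta := fun J i => negbin R (i + v) (J - i)) _ cM) hl'.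
  - by move=> i; rewrite /b !modcM modcX modcN modc1 expr1n mul1r modc_nat.
  - move=> J i; by rewrite negbin_le1 andbT sumr_ge0 // => k _; rewrite divr_ge0 ?exprn_ge0.
  - move=> i; have := @cvg_negbin R (i + v); rewrite -(cvg_centern i); exact.
apply: cvgc_unique hl _.
have := cvgcZ (z := 2 ^+ v.+1) c.
rewrite (_ : (fun n => _) = series (hasse_term f v phi A)) //.
by apply/funext => J; rewrite series_hasse_termE.
Qed.

End euler_transform.

(** * Counting compositions by generating polynomials *)

Section compositions.
Variable K : comNzRingType.

Lemma hockey_stick v M : (\sum_(j < M.+1) 'C(j + v, v) = 'C(M + v.+1, v.+1))%N.
Proof.
elim: M => [|M IH]; first by rewrite big_ord1 !add0n !binn.
by rewrite big_ord_recr /= IH !addnS !addSn binS.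
Qed.

(** Below degree [T] the truncation is invisible, and this is the expansion of
    [(1 - X)^(-(v + 1))]. *)
Lemma coef_truncated_geometric_exp v T M : (M < T)%N ->
  ((\sum_(i < T) 'X^i : {poly K}) ^+ v.+1)`_M = 'C(M + v, v)%:R.
Proof.
have P1 i : (i < T)%N -> (\sum_(i < T) 'X^i : {poly K})`_i = 1.
  move=> iT; rewrite coef_sum (bigD1 (Ordinal iT)) //= coefXn eqxx big1 ?addr0 //.
  by move=> j; rewrite coefXn eq_sym => /negbTE; rewrite -val_eqE /= => ->.
elim: v M => [|v IH] M MT; first by rewrite expr1 P1 // bin0.
rewrite exprS coefMr -hockey_stick natr_sum; apply: eq_bigr => j _.
have jM : (j <= M)%N by rewrite -ltnS.
by rewrite P1 ?mul1r ?IH // (leq_ltn_trans _ MT) // leq_subr.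
Qed.

(** The number of tuples with sum [M < T] is the coefficient of [X^M] in the power of the geometric
    polynomial; this collapses the multiple sum to a single one. *)
Lemma sum_compositions v T (q : nat -> K) :
  \sum_(m : {ffun 'I_v.+1 -> 'I_T} | (\sum_j m j < T)%N) q (\sum_j m j)%N =
  \sum_(M < T) 'C(M + v, v)%:R * q M.
Proof.
have E : (\sum_(i < T) 'X^i : {poly K}) ^+ v.+1 =
    \sum_(m : {ffun 'I_v.+1 -> 'I_T}) 'X^(\sum_j m j).
  rewrite -[v.+1 in LHS]card_ord -prodr_const bigA_distr_bigA /=.
  by apply: eq_bigr => m _; rewrite -expr_sum.
transitivity (\sum_(m : {ffun 'I_v.+1 -> 'I_T} | (\sum_j m j < T)%N)
    \sum_(M < T) (M == \sum_j m j :> nat)%N%:R * q M).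
  apply: eq_bigr => m mT; rewrite (bigD1 (Ordinal mT)) //= eqxx mul1r [X in _ + X]big1 ?addr0 //.
  by move=> M; rewrite -val_eqE /= => /negbTE ->; rewrite mul0r.
rewrite exchange_big /=; apply: eq_bigr => M _; rewrite -mulr_suml; congr (_ * _).
rewrite -(@coef_truncated_geometric_exp v T M) // E coef_sum.
rewrite [RHS](bigID (fun m : {ffun 'I_v.+1 -> 'I_T} => (\sum_j m j < T)%N)) /= [X in _ + X]big1 ?addr0.
  by apply: eq_bigr => m _; rewrite coefXn.
move=> m; rewrite -leqNgt coefXn => Tm; case: eqP => // Mm.
by move: (ltn_ord M); rewrite Mm ltnNge Tm.
Qed.

End compositions.

(** * Finite sums over nested lists and over boxes of indices *)

Lemma sum_uniq_sub (V : nmodType) (I : eqType) (r1 r2 : seq I) (F : I -> V) :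
  uniq r1 -> uniq r2 -> {subset r1 <= r2} ->
  \sum_(i <- r2) F i = \sum_(i <- r1) F i + \sum_(i <- r2 | i \notin r1) F i.
Proof.
move=> u1 u2 s12; rewrite (bigID (mem r1)) /=; congr (_ + _).
rewrite -big_filter; apply: perm_big; apply: uniq_perm => //; first exact: filter_uniq.
by move=> i; rewrite mem_filter andb_idr //; apply: s12.
Qed.

Lemma sum_uniq_sub_le (R : numDomainType) (I : eqType) (r1 r2 : seq I) (F : I -> R) :
  uniq r1 -> uniq r2 -> {subset r1 <= r2} -> (forall i, 0 <= F i) ->
  \sum_(i <- r1) F i <= \sum_(i <- r2) F i.
Proof.
by move=> u1 u2 s12 F0; rewrite (sum_uniq_sub F u1 u2 s12) lerDl sumr_ge0.
Qed.

Section box_sums.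
Variables (R : realType) (w : nat) (z : nat -> R).
Hypothesis z0 : forall n, 0 <= z n.

Definition embed T (g : {ffun 'I_w -> 'I_T}) : {ffun 'I_w -> nat} := [ffun j => g j : nat].
Definition box T : seq {ffun 'I_w -> nat} := [seq embed g | g <- enum {ffun 'I_w -> 'I_T}].

Lemma box_uniq T : uniq (box T).
Proof.
rewrite map_inj_uniq ?enum_uniq // => g h /ffunP E; apply/ffunP => j.
by apply: val_inj; have := E j; rewrite !ffunE.
Qed.

Lemma mem_box T (k : {ffun 'I_w -> nat}) : (k \in box T) = [forall j, (k j < T)%N].
Proof.
apply/mapP/forallP => [[g _ ->] j|h]; first by rewrite ffunE.
exists [ffun j => Ordinal (h j)]; first by rewrite mem_enum.
by apply/ffunP => j; rewrite !ffunE.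
Qed.

Lemma sum_box T : \sum_(k <- box T) \prod_j z (k j) = (series z T) ^+ w.
Proof.
rewrite big_map big_enum /= /series /= big_mkord.
rewrite -[RHS](_ : \prod_(j < w) \sum_(i < T) z i = _); last by rewrite prodr_const card_ord.
rewrite bigA_distr_bigA /=.
by apply: eq_bigr => g _; apply: eq_bigr => j _; rewrite ffunE.
Qed.

(** The list [r] fits into a larger box without meeting the smaller one, and a box sum of a product
    is a power of a partial sum. *)
Lemma sum_outside_box_le (L : R) T0 (r : seq {ffun 'I_w -> nat}) :
  (forall n, series z n <= L) -> uniq r -> (forall k, k \in r -> k \notin box T0) ->
  \sum_(k <- r) \prod_j z (k j) <= L ^+ w - series z T0 ^+ w.
Proof.
move=> hL ur hr.
have P0 (k : {ffun 'I_w -> nat}) : 0 <= \prod_j z (k j) by rewrite prodr_ge0.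
have s0 n : 0 <= series z n by rewrite /series /= sumr_ge0.
(* Adding all entries of all members of [r] makes [T] exceed each of them. *)
pose T := (T0 + \sum_(k <- r) \sum_j (k j).+1)%N.
have rT k : k \in r -> k \in box T.
  move=> kr; rewrite mem_box; apply/forallP => j.
  rewrite /T (big_rem k) //= (bigD1 j) //= -!addnA addnCA leq_addr //.
have T0T : {subset box T0 <= box T}.
  move=> k; rewrite !mem_box => /forallP h; apply/forallP => j.
  by rewrite (leq_trans (h j)) // leq_addr.
apply: (@le_trans _ _ (series z T ^+ w - series z T0 ^+ w)); last first.
  rewrite lerD2r; apply: lerXn2r; rewrite ?nnegrE //; exact: le_trans (s0 T) (hL T).
rewrite lerBrDl -!sum_box (sum_uniq_sub _ (box_uniq T0) (box_uniq T) T0T) lerD2l.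
rewrite -[leRHS]big_filter; apply: sum_uniq_sub_le => //.
  by rewrite filter_uniq // box_uniq.
by move=> k kr; rewrite mem_filter hr // rT.
Qed.

End box_sums.

(** * The multiple series as an unordered sum *)

Section unordered_sum.
Variables (R : realType) (v f : nat) (c : nat -> R[i]) (B : R) (s : R[i]).
Hypothesis f0 : (0 < f)%N.
Hypothesis c_anti : forall A M, c (A + M * f)%N = (-1) ^+ M * c A.
Hypothesis c_bound : forall N, modc (c N) <= B.
Hypothesis s_gt : v.+1%:R < Re s.

Definition L_term (k : {ffun 'I_v.+1 -> nat}) : R[i] := c (total k) * powNC s (total k).

Local Notation z := (fun n : nat => expR (- (Re s / v.+1%:R) * ln n.+1%:R)).

(** Each [k_j + 1] is at most the total [N], so N^(-Re s) is at most the product of the (k_j +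
    1)^(-Re s / w). By [s_gt] every factor has an exponent [Re s / w > 1], which makes the majorant
    summable. *)
Lemma modc_L_term_le k : modc (L_term k) <= B * \prod_j z (k j).
Proof.
have B0 : 0 <= B by exact: le_trans (modc_ge0 _) (c_bound 0).
have s0 : 0 < Re s by apply: lt_trans s_gt.
rewrite modcM; apply: ler_pM; rewrite ?modc_ge0 ?c_bound //.
rewrite /powNC modc_expC ReM /= mulr0 subr0 ReN.
have -> : \prod_j z (k j) = expR (\sum_j - (Re s / v.+1%:R) * ln (k j).+1%:R) by rewrite expR_sum.
rewrite ler_expR -mulr_sumr !mulNr lerN2 mulrAC -mulrA; apply: ler_wpM2l; first exact: ltW.
rewrite ler_pdivrMr // mulr_natr -[X in _ *+ X]card_ord -sumr_const; apply: ler_sum => j _.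
rewrite ler_ln ?posrE ?ltr0n // ?ler_nat (bigD1 j) //= leq_addr //.
Qed.

Definition comb T (p : {ffun 'I_v.+1 -> 'I_f} * {ffun 'I_v.+1 -> 'I_T}) : {ffun 'I_v.+1 -> nat} :=
  [ffun j => (p.1 j + p.2 j * f)%N].

(* The exhaustion of the index set along which the multiple sum is the partial
   sum of the single series over [M = m_1 + ... + m_w], where [k_j = a_j + m_j f]. *)
Definition wedge T : seq {ffun 'I_v.+1 -> nat} :=
  [seq comb p | p <-
     enum [pred p : {ffun 'I_v.+1 -> 'I_f} * {ffun 'I_v.+1 -> 'I_T} | (\sum_j p.2 j < T)%N]].

Lemma wedge_uniq T : uniq (wedge T).
Proof.
rewrite map_inj_uniq ?enum_uniq // => -[a m] [a' m'] /ffunP E.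
have h j : (a j = a' j :> nat) /\ (m j = m' j :> nat).
  have := E j; rewrite !ffunE /= => e.
  have em : a j = a' j :> nat.
    have := congr1 (modn^~ f) e; rewrite /= ![(_ + _ * f)%N]addnC !modnMDl.
    by rewrite !modn_small.
  by split=> //; move: e; rewrite em => /addnI/eqP; rewrite eqn_pmul2r // => /eqP.
by congr pair; apply/ffunP => j; apply: val_inj; have [] := h j.
Qed.

(** With [k_j = a_j + m_j f] the total is that of [a] plus [M f], where [M] is the sum of the [m_j];
    by [c_anti] the term depends on [m] only through [M], and [sum_compositions] applies. *)
Lemma sum_wedge T :
  \sum_(k <- wedge T) L_term k = \sum_(a : {ffun 'I_v.+1 -> 'I_f}) c (total a) *
    \sum_(M < T) (-1) ^+ M * 'C(M + v, v)%:R * powNC s (total a + M * f)%N.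
Proof.
rewrite big_map big_enum_cond /=.
rewrite (eq_bigr (fun p : {ffun 'I_v.+1 -> 'I_f} * {ffun 'I_v.+1 -> 'I_T} =>
   c (total p.1) * ((-1) ^+ (\sum_j p.2 j) * powNC s (total p.1 + (\sum_j p.2 j) * f)%N))); last first.
  move=> p _; rewrite /L_term.
  have -> : total (comb p) = (total p.1 + (\sum_j p.2 j) * f)%N.
    rewrite big_distrl /= -big_split /=; apply: eq_bigr => j _.
    by rewrite ffunE addSn.
  by rewrite c_anti -mulrA mulrCA.
rewrite (eq_bigl (fun p : {ffun 'I_v.+1 -> 'I_f} * {ffun 'I_v.+1 -> 'I_T} =>
   xpredT p.1 && (\sum_j p.2 j < T)%N)); last by move=> p; rewrite inE andbT.
rewrite -(pair_big_dep xpredT (fun _ (m : {ffun 'I_v.+1 -> 'I_T}) => (\sum_j m j < T)%N)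
   (fun (a : {ffun 'I_v.+1 -> 'I_f}) (m : {ffun 'I_v.+1 -> 'I_T}) =>
   c (total a) * ((-1) ^+ (\sum_j m j) * powNC s (total a + (\sum_j m j) * f)%N))) /=.
apply: eq_bigr => a _; rewrite -mulr_sumr; congr (_ * _).
rewrite (sum_compositions v T (fun M => (-1) ^+ M * powNC s (total a + M * f)%N)).
by apply: eq_bigr => M _; ring.
Qed.

(** Division by [f] with remainder gives [a] and [m]; the quotients add up to at most the sum of the
    [k_j], which is below [v.+1 * T0]. *)
Lemma box_sub_wedge T0 T : (v.+1 * T0 <= T)%N -> {subset box v.+1 T0 <= wedge T}.
Proof.
move=> hT k; rewrite mem_box => /forallP kT.
have ls : (\sum_j k j + v.+1 <= T)%N.
  have -> : (\sum_j k j + v.+1 = \sum_j (k j).+1)%N.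
    under [RHS]eq_bigr do rewrite -addn1.
    by rewrite big_split /= sum_nat_const card_ord muln1.
  apply: leq_trans hT; apply: (@leq_trans (\sum_(j < v.+1) T0)); last by rewrite sum_nat_const card_ord.
  by apply: leq_sum => j _; apply: kT.
have md j : (k j %/ f < T)%N.
  apply: (@leq_ltn_trans (k j)); first exact: leq_div.
  apply: leq_trans ls; rewrite addnS ltnS (bigD1 j) //= -addnA leq_addr //.
apply/mapP; exists ([ffun j => Ordinal (ltn_pmod (k j) f0)], [ffun j => Ordinal (md j)]).
  rewrite mem_enum inE /=.
  apply: (@leq_ltn_trans (\sum_j k j)).
    by apply: leq_sum => j _; rewrite ffunE /= leq_div.
  by apply: leq_trans ls; rewrite addnS ltnS leq_addr.
by apply/ffunP => j; rewrite !ffunE /= addnC -divn_eq.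
Qed.

(** Along the wedges the sums tend to [l]. A finite set containing a large wedge differs from it
    only by indices outside a large box, and their contribution is small by the product majorant. *)
Lemma cvg_unordered_sum (la : {ffun 'I_v.+1 -> 'I_f} -> R[i]) :
  (forall a : {ffun 'I_v.+1 -> 'I_f}, cvgc (series (fun M =>
     (-1) ^+ M * 'C(M + v, v)%:R * powNC s (total a + M * f)%N)) (la a)) ->
  summability.partial_sum (L_term : _ -> R[i]^o) @ summability.totally
    --> (\sum_(a : {ffun 'I_v.+1 -> 'I_f}) c (total a) * la a : R[i]^o).
Proof.
move=> hla; set l := \sum_a _.
have B0 : 0 <= B by exact: le_trans (modc_ge0 _) (c_bound 0).
have cw : cvgc (fun T => \sum_(k <- wedge T) L_term k) l.
  have := cvgc_sum (r := index_enum _) (fun a : {ffun 'I_v.+1 -> 'I_f} => cvgcZ (z := c (total a)) (hla a)).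
  congr cvgc; apply/funext => T; rewrite sum_wedge; apply: eq_bigr => a _.
  by rewrite /series /= big_mkord.
have z0 n : 0 <= z n by exact: expR_ge0.
have cz : cvgn (series z).
  by apply: is_cvg_series_pseries; rewrite ltr_pdivlMr // mul1r.
have inc : nondecreasing_seq (series z).
  by apply/nondecreasing_seqP => k; rewrite /series /= big_nat_recr //= lerDl.
pose L : R := limn (series z).
have leL n : series z n <= L by exact: nondecreasing_cvgn_le.
have FF : Filter (@summability.totally {ffun 'I_v.+1 -> nat}).
  exact: (@filter_filter _ _ summability.totally_filter).
apply/cvgCP => e e0.
have e2 : 0 < e / 2 by lra.
have cX n : (fun T => series z T ^+ n) @ \oo --> L ^+ n.
  elim: n => [|n IH]; first exact: cvg_cst.
  rewrite exprS; under eq_fun do rewrite exprS.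
  by apply: cvgM.
have [T0 hT0] : exists T0, B * (L ^+ v.+1 - series z T0 ^+ v.+1) < e / 2.
  have h : (fun T => B * (L ^+ v.+1 - series z T ^+ v.+1)) @ \oo --> B * (L ^+ v.+1 - L ^+ v.+1).
    apply: cvgMr; apply: cvgB; first exact: cvg_cst.
    exact: cX.
  move: h; rewrite subrr mulr0 => /cvgrPdist_lt/(_ _ e2)[T _ /(_ T (leqnn _))].
  rewrite sub0r normrN => h; exists T; exact: le_lt_trans (ler_norm _) h.
(* [T] is large enough both for the wedge sum to be near [l] and for the wedge to contain the box of
   side [T0]. *)
have [T [hT1 hT2]] : exists T, (v.+1 * T0 <= T)%N /\ modc (\sum_(k <- wedge T) L_term k - l) < e / 2.
  move/cvgCP : cw => /(_ _ e2) [T1 _ hT1]; exists (maxn T1 (v.+1 * T0)).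
  by split; [exact: leq_maxr | apply: hT1; exact: leq_maxl].
exists [fset k in wedge T]%fset => // S /= /fsubsetP hS.
have {}hS : {subset wedge T <= enum_fset S}.
  by move=> k kW; apply: hS; rewrite !inE.
rewrite /summability.partial_sum.
rewrite -(big_seq_fsetE +%R S xpredT L_term) /=.
rewrite (sum_uniq_sub _ (wedge_uniq T) (fset_uniq S) hS) addrAC.
apply: le_lt_trans (modcD _ _) _.
suff : modc (\sum_(k <- S | k \notin wedge T) L_term k) < e / 2 by lra.
apply: le_lt_trans hT0; apply: le_trans (modc_sum _ _ _) _.
apply: (@le_trans _ _ (\sum_(k <- S | k \notin wedge T) B * \prod_j z (k j))).
  by apply: ler_sum => k _; apply: modc_L_term_le.
rewrite -mulr_sumr; apply: ler_wpM2l => //; rewrite -big_filter.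
apply: sum_outside_box_le => //; first by rewrite filter_uniq ?fset_uniq.
move=> k; rewrite mem_filter => /andP[kW _]; apply: contra kW.
exact: box_sub_wedge.
Qed.

End unordered_sum.

(** * Asymptotics at 0 along positive reals *)

Section jets.
Variable R : realType.
Implicit Types (F G : R -> R[i]) (n m : nat).

Lemma cvgc_cst (z : R[i]) : cvgc (fun=> z) z.
Proof. exact: cvg_cst. Qed.

Definition bigO0 n F := exists C : R, \forall x \near 0^'+, modc (F x) <= C * x ^+ n.

Lemma near0_itv : \forall x \near (0 : R)^'+, 0 < x < 1.
Proof.
near=> x; apply/andP; split; first by near: x; exact: nbhs_right_gt.
by near: x; exact: nbhs_right_lt.
Unshelve. all: by end_near. Qed.

Lemma bigO0_ge0 n F : bigO0 n F ->
  exists2 C : R, 0 <= C & \forall x \near 0^'+, modc (F x) <= C * x ^+ n.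
Proof.
case=> C hC; exists `|C| => //; near=> x.
have x01 : 0 < x < 1 by near: x; exact: near0_itv.
have : modc (F x) <= C * x ^+ n by near: x.
move/le_trans; apply; apply: ler_wpM2r; last exact: ler_norm.
by rewrite exprn_ge0 //; lra.
Unshelve. all: by end_near. Qed.

Lemma bigO0D n F G : bigO0 n F -> bigO0 n G -> bigO0 n (fun x => F x + G x).
Proof.
case=> C hC [D hD]; exists (C + D); near=> x.
apply: le_trans (modcD _ _) _; rewrite mulrDl; apply: lerD.
- by near: x.
- by near: x.
Unshelve. all: by end_near. Qed.

Lemma bigO0_weak m n F : (m <= n)%N -> bigO0 n F -> bigO0 m F.
Proof.
move=> mn /bigO0_ge0[C C0 hC]; exists C; near=> x.
have x01 : 0 < x < 1 by near: x; exact: near0_itv.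
have : modc (F x) <= C * x ^+ n by near: x.
move/le_trans; apply; apply: ler_wpM2l => //; apply: ler_wiXn2l => //; lra.
Unshelve. all: by end_near. Qed.

Lemma bigO0M m n F G : bigO0 m F -> bigO0 n G -> bigO0 (m + n) (fun x => F x * G x).
Proof.
move=> /bigO0_ge0[C C0 hC] /bigO0_ge0[D D0 hD]; exists (C * D); near=> x.
rewrite modcM exprD mulrACA; apply: ler_pM; rewrite ?modc_ge0 //.
- by near: x.
- by near: x.
Unshelve. all: by end_near. Qed.

Lemma bigO0_eq n F G : (forall x, 0 < x -> F x = G x) -> bigO0 n F -> bigO0 n G.
Proof.
move=> e [C hC]; exists C; near=> x.
have x01 : 0 < x < 1 by near: x; exact: near0_itv.
by rewrite -e; [near: x|lra].
Unshelve. all: by end_near. Qed.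

Lemma bigO0_cst (z : R[i]) : bigO0 0 (fun=> z).
Proof. by exists (modc z); near=> x; rewrite mulr1. Unshelve. all: by end_near. Qed.

Lemma bigO0_0 n : bigO0 n (fun=> 0).
Proof. by exists 0; near=> x; rewrite modc0 mul0r. Unshelve. all: by end_near. Qed.

Lemma bigO0Z (z : R[i]) n F : bigO0 n F -> bigO0 n (fun x => z * F x).
Proof. exact: (bigO0M (bigO0_cst z)). Qed.

Lemma bigO0B n F G : bigO0 n F -> bigO0 n G -> bigO0 n (fun x => F x - G x).
Proof.
move=> hF /(bigO0Z (-1)) hG; apply: bigO0_eq (bigO0D hF hG) => x _.
by rewrite mulN1r.
Qed.

Lemma bigO0_sum (I : Type) (r : seq I) (F : I -> R -> R[i]) n :
  (forall i, bigO0 n (F i)) -> bigO0 n (fun x => \sum_(i <- r) F i x).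
Proof.
move=> h; elim: r => [|i r IH].
  by apply: bigO0_eq (bigO0_0 n) => x _; rewrite big_nil.
by apply: bigO0_eq (bigO0D (h i) IH) => x _; rewrite big_cons.
Qed.

Lemma bigO0X k n F : bigO0 n F -> bigO0 (k * n) (fun x => F x ^+ k).
Proof.
move=> h; elim: k => [|k IH]; first exact: bigO0_cst.
by rewrite mulSn; apply: bigO0_eq (bigO0M h IH) => x _; rewrite exprS.
Qed.

Lemma bigO0_id : bigO0 1 (fun x => x%:C).
Proof.
exists 1; near=> x; have x01 : 0 < x < 1 by near: x; exact: near0_itv.
by rewrite mul1r modc_real ger0_norm //; lra.
Unshelve. all: by end_near. Qed.

(** The constant term is [O(x)], hence zero; division by [x] lowers the order by one and the
    induction continues. *)
Lemma bigO0_poly_eq0 n (d : nat -> R[i]) :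
  bigO0 n (fun x => \sum_(m < n) d m * x%:C ^+ m) -> forall m, (m < n)%N -> d m = 0.
Proof.
elim: n d => [//|n IH] d h.
have d0 : d 0%N = 0.
  have h1 : bigO0 1 (fun x => \sum_(m < n.+1) d m * x%:C ^+ m - x%:C * \sum_(m < n) d m.+1 * x%:C ^+ m).
    apply: bigO0B; first by apply: bigO0_weak h.
    apply: (bigO0M bigO0_id); apply: bigO0_sum => i.
    by apply: bigO0Z; apply: bigO0_weak (bigO0X i bigO0_id).
  have {h1}/bigO0_ge0[C C0 hC] : bigO0 1 (fun=> d 0%N).
    apply: bigO0_eq h1 => x _; rewrite big_ord_recl /= expr0 mulr1 mulr_sumr.
    under [X in _ - X]eq_bigr => i _ do rewrite mulrCA -exprS.
    by rewrite addrK.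
  apply/eqP; rewrite -modc_eq0; apply/eqP/le_anti; rewrite modc_ge0 andbT.
  apply/ler_addgt0Pr => e e0; rewrite add0r.
  near (0 : R)^'+ => x.
  have x01 : 0 < x < 1 by near: x; exact: near0_itv.
  have hx : modc (d 0%N) <= C * x ^+ 1 by near: x.
  apply: le_trans hx _; rewrite expr1.
  have : x < e / (C + 1) by near: x; apply: nbhs_right_lt; rewrite divr_gt0 //; lra.
  rewrite ltr_pdivlMr; last lra.
  nra.
case=> [//|m] mn.
apply: (IH (fun m => d m.+1)) => //.
have [C hC] := h; exists C; near=> x.
have x01 : 0 < x < 1 by near: x; exact: near0_itv.
have x0 : 0 < x by lra.
have : modc (\sum_(m < n.+1) d m * x%:C ^+ m) <= C * x ^+ n.+1 by near: x.
rewrite big_ord_recl d0 mul0r add0r.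
have -> : \sum_(i < n) d (lift ord0 i) * x%:C ^+ (lift ord0 i) = x%:C * \sum_(m < n) d m.+1 * x%:C ^+ m.
  by rewrite mulr_sumr; apply: eq_bigr => i _; rewrite mulrCA -exprS.
by rewrite modcM modc_real (gtr0_norm x0) exprS mulrCA ler_pM2l.
Unshelve. all: by end_near. Qed.

(** Since [(i + n)! >= i!], the tail is termwise at most [y^n] times the exponential series. *)
Lemma expR_taylor_le n (y : R) : 0 <= y ->
  `|expR y - \sum_(m < n) y ^+ m / m`!%:R| <= expR y * y ^+ n.
Proof.
move=> y0.
have c := @is_cvg_series_exp_coeff R y.
have e0 m : 0 <= exp_coeff y m by rewrite exp_coeff_ge0.
have inc : nondecreasing_seq (series (exp_coeff y)).
  by apply/nondecreasing_seqP => k; rewrite /series /= big_nat_recr //= lerDl.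
have leE k : series (exp_coeff y) k <= expR y by exact: nondecreasing_cvgn_le.
have En : \sum_(m < n) y ^+ m / m`!%:R = series (exp_coeff y) n.
  by rewrite /series /= big_mkord.
rewrite En ger0_norm ?subr_ge0 // lerBlDl.
apply: limr_le => //; near=> k.
have nk : (n <= k)%N by near: k; exact: nbhs_infty_ge.
rewrite /series /= (big_cat_nat (n := n)) //= lerD2l.
rewrite -{1}[n]add0n big_addn -[leLHS]/(\sum_(0 <= i < k - n) (y ^+ (i + n) / (i + n)`!%:R)).
apply: (@le_trans _ _ (\sum_(0 <= i < k - n) exp_coeff y i * y ^+ n)).
  apply: ler_sum => i _; rewrite /exp_coeff /= exprD mulrAC -!mulrA; apply: ler_wpM2l; first exact: exprn_ge0.
  apply: ler_wpM2r; first exact: exprn_ge0.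
  by rewrite lef_pV2 ?posrE ?ltr0n ?fact_gt0 // ler_nat (leq_trans _ (fact_ratio_ge i n)) // leq_pmull // expn_gt0.
rewrite -mulr_suml; apply: ler_wpM2r; [exact: exprn_ge0|exact: leE].
Unshelve. all: by end_near. Qed.

Lemma bigO0_exp n (A : nat) :
  bigO0 n (fun x => expC (x%:C * A%:R) - \sum_(m < n) x%:C ^+ m / m`!%:R * A%:R ^+ m).
Proof.
exists (expR A%:R * A%:R ^+ n); near=> x.
have x01 : 0 < x < 1 by near: x; exact: near0_itv.
have xA : x%:C * A%:R = (x * A%:R)%:C by rewrite rmorphM rmorph_nat.
have -> : expC (x%:C * A%:R) - \sum_(m < n) x%:C ^+ m / m`!%:R * A%:R ^+ m =
   (expR (x * A%:R) - \sum_(m < n) (x * A%:R) ^+ m / m`!%:R)%:C.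
  rewrite rmorphB /= -expC_real -xA; congr (_ - _); rewrite rmorph_sum /=.
  apply: eq_bigr => m _; rewrite rmorphM fmorphV rmorphXn /= -xA rmorph_nat exprMn.
  by rewrite mulrAC.
have A0 : (0 : R) <= A%:R by [].
rewrite modc_real; apply: le_trans (expR_taylor_le _ _) _; first by rewrite mulr_ge0 //; lra.
rewrite exprMn [x ^+ n * _]mulrC mulrA; apply: ler_wpM2r; first by rewrite exprn_ge0 //; lra.
apply: ler_wpM2r; first exact: exprn_ge0.
by rewrite ler_expR; nra.
Unshelve. all: by end_near. Qed.

(** Convergence at some [x0 < r] bounds [|a_m| x0^m] by [B]; for [x < x0/2] the tail is dominated by
    a geometric series of ratio below 1/2, hence by [2 B (x/x0)^n]. *)
Lemma bigO0_power_series n (a : nat -> R[i]) (F : R -> R[i]) (r : R) : 0 < r ->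
  (forall x, 0 < x < r -> cvgc (series (fun m => a m * x%:C ^+ m)) (F x)) ->
  bigO0 n (fun x => F x - \sum_(m < n) a m * x%:C ^+ m).
Proof.
move=> r0 hF.
have [x0 x00 x0r] : exists2 x0 : R, 0 < x0 & x0 < r by exists (r / 2); lra.
have [B B0 hB] : exists2 B : R, 0 <= B & forall m, modc (a m) * x0 ^+ m <= B.
  have c : cvgc (series (fun m => a m * x0%:C ^+ m)) (F x0) by apply: hF; rewrite x00.
  move/cvgCP : (c) => /(_ _ ltr01)[N _ hN].
  pose S := \sum_(i < N) modc (a i * x0%:C ^+ i).
  have S0 : 0 <= S by rewrite sumr_ge0 // => i _; rewrite modc_ge0.
  (* From index [N] on, consecutive partial sums are both within 1 of the limit, so a term is at
     most 2. *)
  exists (S + 2); first by lra.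
  move=> m; have -> : modc (a m) * x0 ^+ m = modc (a m * x0%:C ^+ m).
    by rewrite modcM modcX modc_real gtr0_norm.
  have [mN|Nm] := ltnP m N.
    rewrite /S (bigD1 (Ordinal mN)) //= -addrA lerDl addr_ge0 //.
    by rewrite sumr_ge0 // => i _; rewrite modc_ge0.
  have h1 := hN m Nm; have h2 := hN m.+1 (leqW Nm).
  have -> : a m * x0%:C ^+ m = (series (fun m => a m * x0%:C ^+ m) m.+1 - F x0) -
      (series (fun m => a m * x0%:C ^+ m) m - F x0).
    by rewrite /series /= big_nat_recr //=; ring.
  apply: le_trans (modcB _ _) _; move: h1 h2 => /=; lra.
exists (2 * B / x0 ^+ n); near=> x.
have xp : 0 < x by near: x; exact: nbhs_right_gt.
have xs : x < x0 / 2 by near: x; apply: nbhs_right_lt; lra.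
have cx : cvgc (series (fun m => a m * x%:C ^+ m)) (F x) by apply: hF; rewrite xp /=; lra.
have c2 := cvgcD cx (cvgc_cst (z := - \sum_(m < n) a m * x%:C ^+ m)).
apply: lim_modc_le c2 _; near=> k.
have nk : (n <= k)%N by near: k; exact: nbhs_infty_ge.
rewrite /series /= -[\sum_(m < n) _](big_mkord xpredT (fun m => a m * x%:C ^+ m)).
rewrite (big_cat_nat (n := n)) //= addrAC subrr add0r.
pose q := x / x0; have q0 : 0 < q by rewrite divr_gt0.
have q1 : q < 1 / 2 by rewrite /q ltr_pdivrMr //; lra.
apply: le_trans (modc_sum _ _ _) _.
apply: (@le_trans _ _ (\sum_(n <= m < k) B * q ^+ m)).
  apply: ler_sum => m _; rewrite modcM modcX modc_real gtr0_norm //.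
  rewrite /q expr_div_n mulrCA mulrC mulrA ler_pdivlMr ?exprn_gt0 // mulrAC.
  by rewrite -mulrA; apply: ler_wpM2l; [rewrite exprn_ge0 // ltW|rewrite mulrC].
rewrite -mulr_sumr.
have -> : 2 * B / x0 ^+ n * x ^+ n = B * (2 * q ^+ n).
  by rewrite /q expr_div_n; move: (x0 ^+ n) (x ^+ n) => b c; ring.
apply: ler_wpM2l => //.
rewrite -[n in \sum_(n <= _ < _) _]add0n big_addn.
under eq_bigr do rewrite exprD.
rewrite -mulr_suml; apply: ler_wpM2r; first by rewrite exprn_ge0 // ltW.
suff : (1 - q) * \sum_(0 <= i < k - n) q ^+ i <= 1.
  have : 0 <= \sum_(0 <= i < k - n) q ^+ i by rewrite sumr_ge0 // => i _; rewrite exprn_ge0 // ltW.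
  by move: (\sum_(0 <= i < k - n) q ^+ i) => T; nra.
by rewrite big_mkord -opprB mulNr -subrX1 opprB gerBl exprn_ge0 // ltW.
Unshelve. all: by end_near. Qed.

End jets.

(** * Values at negative integers and Taylor coefficients *)

Section special_values.
Variables (R : realType) (v f : nat).

Local Notation natpow m := (fun N : nat => N%:R ^+ m : R[i]).

Lemma iter_diffNS j (phi : nat -> R[i]) A :
  iter j.+1 (diffN f) phi A = iter j (diffN f) phi A - iter j (diffN f) phi (A + f)%N.
Proof. by []. Qed.

(** Leibniz rule for differences with the factor [N], whose difference is the constant [- f]; it
    drives the induction on the degree below. *)
Lemma iter_diffN_mul_id j (phi : nat -> R[i]) A :
  iter j.+1 (diffN f) (fun N => N%:R * phi N) A =
  A%:R * iter j.+1 (diffN f) phi A - (j.+1 * f)%:R * iter j (diffN f) phi (A + f)%N.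
Proof.
elim: j A => [|j IH] A; first by rewrite /= /diffN mul1n natrD; ring.
rewrite [LHS]iter_diffNS !IH !iter_diffNS.
by rewrite !natrM [(A + f)%:R]natrD -[j.+2%:R]natr1; ring.
Qed.

Lemma iter_diffN_natpow m j A : (m < j)%N -> iter j (diffN f) (natpow m) A = 0.
Proof.
elim: m j A => [|m IH] [//|j] A mj.
  rewrite iterSr (_ : diffN f _ = fun=> 0); last by apply/funext => N; rewrite /diffN subrr.
  by elim: j {mj} A => [//|j IHj] A; rewrite iterS /diffN !IHj subrr.
rewrite (_ : natpow m.+1 = fun N => N%:R * N%:R ^+ m); last by apply/funext => N; rewrite exprS.
by rewrite iter_diffN_mul_id !IH ?mulr0 ?subrr //; exact: ltnW.
Qed.

Lemma hasse_term_natpow m j A : (m < j)%N -> hasse_term f v (natpow m) A j = 0.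
Proof. by move=> mj; rewrite /hasse_term iter_diffN_natpow // mulr0. Qed.

Lemma powNC_natpow m N : (0 < N)%N -> powNC (- m%:R) N = N%:R ^+ m :> R[i].
Proof.
move=> N0; rewrite /powNC opprK expC_natM expC_real lnK ?posrE ?ltr0n //.
by rewrite rmorph_nat.
Qed.

Lemma eq_hasse_term (phi psi : nat -> R[i]) A j :
  (forall N, (A <= N)%N -> phi N = psi N) -> hasse_term f v phi A j = hasse_term f v psi A j.
Proof.
move=> e; rewrite /hasse_term !iter_diffNE; congr (_ * _); apply: eq_bigr => i _.
by rewrite e // leq_addr.
Qed.

(** The value at [s = - m] of the entire function given by the Hasse series: the terms with [j > m]
    vanish. *)
Definition hasse_value A m : R[i] := \sum_(j < m.+1) hasse_term f v (natpow m) A j.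

Lemma hasse_valueE n A m : (m < n)%N ->
  \sum_(j < n) hasse_term f v (natpow m) A j = hasse_value A m.
Proof.
move=> mn; rewrite /hasse_value.
rewrite -!(big_mkord xpredT (hasse_term f v (natpow m) A)) (big_cat_nat (n := m.+1)) //=.
rewrite [X in _ + X]big_nat [X in _ + X]big1 ?addr0 // => j /andP[mj _].
exact: hasse_term_natpow.
Qed.

Lemma cvgc_hasse_value A m : (0 < A)%N ->
  cvgc (series (hasse_term f v (powNC (- m%:R)) A)) (hasse_value A m).
Proof.
move=> A0; apply/cvgCP => e e0; near=> n.
have mn : (m < n)%N by near: n; exact: nbhs_infty_ge.
rewrite /series /= big_mkord -(hasse_valueE A mn) -sumrB big1 ?modc0 // => j _.
rewrite (eq_hasse_term (psi := natpow m)) ?subrr // => N AN.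
by rewrite powNC_natpow // (leq_trans A0).
Unshelve. all: by end_near. Qed.

(** The eigenvalue of [D/2] on the function [e^(x N)] of [N]; thus
    [1 - delta x = (e^(f x) + 1)/2]. *)
Local Notation delta x := ((1 - expC (f%:R * x%:C)) / 2 : R[i]).

Lemma expC_natM_real (x : R) (N : nat) : expC (x%:C * N%:R) = (expR (x * N%:R))%:C.
Proof. by rewrite -expC_real rmorphM rmorph_nat. Qed.

Lemma bigO0_delta : bigO0 1 (fun x : R => delta x).
Proof.
apply: bigO0_eq (bigO0Z (- 2^-1) (bigO0_exp R 1 f)) => x _.
by rewrite big_ord1 expr0 fact0 divr1 expr0 mulr1 (mulrC _ f%:R); field.
Qed.

Lemma bigO0_bounded n (F : R -> R[i]) : bigO0 n F -> bigO0 0 F.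
Proof. exact: bigO0_weak. Qed.

(** Multiplying a truncated expansion of [(1 - y)^(-(k + 2))] by [1 - y] gives that of
    [(1 - y)^(-(k + 1))] up to one boundary term, by Pascal's rule. *)
Lemma truncated_binomial_step n k (y : R[i]) :
  (1 - y) * \sum_(j < n) 'C(j + k.+1, k.+1)%:R * y ^+ j =
  \sum_(j < n) 'C(j + k, k)%:R * y ^+ j - 'C(n + k, k.+1)%:R * y ^+ n.
Proof.
elim: n => [|n IH]; first by rewrite !big_ord0 add0n bin_small // mulr0 mul0r subrr.
rewrite !big_ord_recr /= mulrDr IH addSn !addnS !binS !natrD exprS; ring.
Qed.

(** Induction on [k] from the finite geometric sum; every boundary term contains [delta x ^+ n],
    which is [O(x^n)]. *)
Lemma bigO0_binomial_series n k : bigO0 n (fun x : R =>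
  (1 - delta x) ^+ k.+1 * \sum_(j < n) 'C(j + k, k)%:R * delta x ^+ j - 1).
Proof.
have dn : bigO0 n (fun x : R => delta x ^+ n).
  by rewrite -[n in bigO0 n]muln1; apply: bigO0X bigO0_delta.
elim: k => [|k IH].
  apply: bigO0_eq (bigO0Z (-1) dn) => x _; move: (delta x) => y.
  under eq_bigr do rewrite bin0 mul1r.
  have -> : (1 - y) ^+ 1 * \sum_(i < n) y ^+ i = 1 - y ^+ n.
    by rewrite expr1 -opprB mulNr -subrX1 opprB.
  by ring.
have d0 : bigO0 0 (fun x : R => (1 - delta x) ^+ k.+1).
  have d1 : bigO0 0 (fun x : R => 1 - delta x).
    by apply: bigO0B; [exact: bigO0_cst | apply: bigO0_bounded bigO0_delta].
  by have := bigO0X k.+1 d1; rewrite muln0.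
have h := bigO0Z (- 'C(n + k, k.+1)%:R) (bigO0M d0 dn).
apply: bigO0_eq (bigO0D IH h) => x _; move: (delta x) => y.
rewrite [(1 - y) ^+ k.+2]exprSr -[in RHS]mulrA truncated_binomial_step.
by move: ((1 - y) ^+ k.+1) => z; ring.
Qed.

Lemma hasse_term_expE (x : R) A j :
  hasse_term f v (fun N => expC (x%:C * N%:R)) A j =
  expC (x%:C * A%:R) * ('C(j + v, v)%:R * delta x ^+ j).
Proof.
rewrite /hasse_term.
have -> : iter j (diffN f) (fun N => expC (x%:C * N%:R)) A =
    expC (x%:C * A%:R) * (1 - expC (f%:R * x%:C)) ^+ j.
  elim: j A => [|j IH] A; first by rewrite mulr1.
  by rewrite iterS /diffN !IH natrD mulrDr expCD (mulrC x%:C f%:R) exprS; ring.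
by rewrite expr_div_n; ring.
Qed.

Lemma bigO0_hasse_term n A j (phi : R -> nat -> R[i]) :
  (forall N, bigO0 n (fun x => phi x N)) ->
  bigO0 n (fun x => hasse_term f v (phi x) A j).
Proof.
move=> h; apply: bigO0Z; elim: j A => [|j IH] A; first exact: h.
exact: (bigO0B (IH A) (IH (A + f)%N)).
Qed.

Lemma hasse_term_sum (I : Type) (r : seq I) (b : I -> R[i]) (phi : I -> nat -> R[i]) A j :
  hasse_term f v (fun N => \sum_(i <- r) b i * phi i N) A j =
  \sum_(i <- r) b i * hasse_term f v (phi i) A j.
Proof.
elim: r => [|i r IH].
  rewrite big_nil (eq_hasse_term (psi := fun N => 0 * 1 + 0 * 1)).
    by rewrite (hasse_term_lin f v j 0 0 (fun=> 1) (fun=> 1)); ring.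
  by move=> N _; rewrite big_nil; ring.
rewrite big_cons -IH (eq_hasse_term (psi := fun N => b i * phi i N + 1 * \sum_(i <- r) b i * phi i N)).
  by rewrite hasse_term_lin mul1r.
by move=> N _; rewrite big_cons mul1r.
Qed.

(** Two approximations are added: [h1] truncates the binomial series of [(1 - delta x)^(-w)], and
    [h2] replaces [e^(x N)] by its Taylor polynomial inside the first [n] Hasse terms. *)
Lemma bigO0_quotient n A : bigO0 n (fun x : R =>
  expC (x%:C * A%:R) / (1 - delta x) ^+ v.+1 -
  \sum_(m < n) x%:C ^+ m / m`!%:R * hasse_value A m).
Proof.
have E x : 1 - delta x = ((1 + expR (x * f%:R)) / 2)%:C.
  rewrite (mulrC f%:R) expC_natM_real rmorphM rmorphD fmorphV rmorph1 rmorph_nat.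
  by field.
(* For [x > 0] the base [1 - delta x] is at least 1, so its inverse powers stay bounded. *)
have inv0 : bigO0 0 (fun x : R => ((1 - delta x) ^+ v.+1)^-1).
  exists 1; near=> x; have x01 : 0 < x < 1 by near: x; exact: near0_itv.
  have e1 : 1 <= (1 + expR (x * f%:R)) / 2.
    have : 1 <= expR (x * f%:R) by rewrite -expR0 ler_expR mulr_ge0 //; lra.
    lra.
  rewrite E modcV modcX modc_real ger0_norm; last lra.
  by rewrite mulr1 invf_le1 ?exprn_ege1 // exprn_gt0 //; lra.
have exp0 : bigO0 0 (fun x : R => expC (x%:C * A%:R)).
  by apply: bigO0_eq (bigO0_exp R 0 A) => x _; rewrite big_ord0 subr0.
have h1 := bigO0Z (-1) (bigO0M (bigO0M exp0 inv0) (bigO0_binomial_series n v)).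
have h2 : bigO0 n (fun x : R => \sum_(j < n) hasse_term f v
    (fun N => expC (x%:C * N%:R) - \sum_(m < n) x%:C ^+ m / m`!%:R * N%:R ^+ m) A j).
  by apply: bigO0_sum => j; apply: bigO0_hasse_term => N; apply: bigO0_exp.
apply: bigO0_eq (bigO0D h1 h2) => x x0.
have nz : (1 - delta x) ^+ v.+1 != 0.
  have ep := expR_gt0 (x * f%:R).
  by rewrite expf_neq0 // E -modc_eq0 modc_real normr_eq0 lt0r_neq0 //; lra.
have -> : \sum_(j < n) hasse_term f v
    (fun N => expC (x%:C * N%:R) - \sum_(m < n) x%:C ^+ m / m`!%:R * N%:R ^+ m) A j =
  expC (x%:C * A%:R) * (\sum_(j < n) 'C(j + v, v)%:R * delta x ^+ j) -
  \sum_(m < n) x%:C ^+ m / m`!%:R * hasse_value A m.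
  rewrite (eq_bigr (fun j : 'I_n => expC (x%:C * A%:R) * ('C(j + v, v)%:R * delta x ^+ j) -
     \sum_(m < n) x%:C ^+ m / m`!%:R * hasse_term f v (natpow m) A j)).
    rewrite sumrB -mulr_sumr; congr (_ - _); rewrite exchange_big /=.
    by apply: eq_bigr => m _; rewrite -mulr_sumr hasse_valueE.
  move=> j _; rewrite -hasse_term_expE -hasse_term_sum.
  rewrite (eq_hasse_term (psi := fun N => 1 * expC (x%:C * N%:R) +
     (-1) * \sum_(m < n) x%:C ^+ m / m`!%:R * N%:R ^+ m)).
    by rewrite hasse_term_lin mul1r mulN1r.
  by move=> N _; rewrite mul1r mulN1r.
move: nz; move: ((1 - delta x) ^+ v.+1) => D D0.
move: (\sum_(j < n) _) => S; move: (\sum_(m < n) _) => T.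
by field.
Unshelve. all: by end_near. Qed.

(** As [2^w / (e^(f x) + 1)^w = (1 - delta x)^(-w)], the generating function is [x^w] times a
    combination of the quotients of [bigO0_quotient]; its power series must have the same
    coefficients. *)
Lemma genocchi_coefficients (c : nat -> R[i]) (G : nat -> R[i]) n : (0 < f)%N ->
  (forall t : R[i], `|t| < (pi / f%:R)%:C ->
    cvgc (series (fun m => G m * (t ^+ m / m`!%:R)))
      ((2 * t) ^+ v.+1 * \sum_(a : {ffun 'I_v.+1 -> 'I_f})
         (c (total a) * expC (t * (total a)%:R) / (expC (f%:R * t) + 1) ^+ v.+1))) ->
  G (n + v.+1)%N / (n + v.+1)`!%:R =
    (\sum_(a : {ffun 'I_v.+1 -> 'I_f}) c (total a) * hasse_value (total a) n) / n`!%:R.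
Proof.
move=> f0 hG.
pose ell m := \sum_(a : {ffun 'I_v.+1 -> 'I_f}) c (total a) * hasse_value (total a) m.
pose gf (x : R) := (2 * x%:C) ^+ v.+1 * \sum_(a : {ffun 'I_v.+1 -> 'I_f})
         (c (total a) * expC (x%:C * (total a)%:R) / (expC (f%:R * x%:C) + 1) ^+ v.+1).
have r0 : 0 < (pi : R) / f%:R by rewrite divr_gt0 ?pi_gt0 // ltr0n.
(* One more than the exponent [n + w] whose coefficients are compared. *)
pose N := (n.+1 + v.+1)%N.
have h1 : bigO0 N (fun x => gf x - \sum_(m < N) (G m / m`!%:R) * x%:C ^+ m).
  apply: (@bigO0_power_series _ N (fun m => G m / m`!%:R) gf _ r0) => x /andP[x0 xr].
  have := hG x%:C; rewrite normE modc_real gtr0_norm // ltcR => /(_ xr).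
  congr (cvgc (series _)); apply/funext => m; ring.
have h2 : bigO0 N (fun x => gf x - x%:C ^+ v.+1 * \sum_(m < n.+1) x%:C ^+ m / m`!%:R * ell m).
  have hx : bigO0 v.+1 (fun x : R => x%:C ^+ v.+1).
    by have := bigO0X v.+1 (bigO0_id R); rewrite muln1.
  rewrite /N addnC.
  have hs := bigO0_sum (index_enum _) (fun a : {ffun 'I_v.+1 -> 'I_f} =>
    bigO0Z (c (total a)) (bigO0_quotient n.+1 (total a))).
  apply: bigO0_eq (bigO0M hx hs) => x x0.
  rewrite /gf exprMn -!mulrA mulrCA -mulrBr; congr (_ * _).
  have -> : \sum_(m < n.+1) x%:C ^+ m / m`!%:R * ell m =
     \sum_(a : {ffun 'I_v.+1 -> 'I_f}) c (total a) * \sum_(m < n.+1) x%:C ^+ m / m`!%:R * hasse_value (total a) m.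
    under [RHS]eq_bigr do rewrite mulr_sumr.
    rewrite exchange_big /=; apply: eq_bigr => m _; rewrite mulr_sumr.
    by apply: eq_bigr => a _; rewrite mulrCA.
  rewrite [X in _ = X - _]mulr_sumr -[RHS]sumrB; apply: eq_bigr => a _.
  rewrite [LHS]mulrBr; apply: (congr1 (fun z => z - _)).
  have -> : (1 - delta x) = (expC (f%:R * x%:C) + 1) / 2 by field.
  rewrite expr_div_n invfM invrK.
  by move: (c _) (expC _) (_ ^+ v.+1) (_ ^- v.+1) => ? ? ? ?; ring.
have h3 := bigO0B h2 h1.
(* The factor [x^w] shifts the Hasse coefficients by [w], with zeros below. *)
pose d m := G m / m`!%:R - (if (v.+1 <= m)%N then ell (m - v.+1)%N / (m - v.+1)`!%:R else 0).
have {h3}h4 : bigO0 N (fun x => \sum_(m < N) d m * x%:C ^+ m).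
  have E (g S T : R[i]) : g - S - (g - T) = T - S by ring.
  apply: bigO0_eq h3 => x _; rewrite E.
  rewrite [RHS](eq_bigr (fun m : 'I_N => G m / m`!%:R * x%:C ^+ m -
     (if (v.+1 <= m)%N then ell (m - v.+1)%N / (m - v.+1)`!%:R else 0) * x%:C ^+ m)); last first.
    by move=> m _; rewrite /d mulrBl.
  rewrite [RHS]sumrB; congr (_ - _).
  rewrite -[RHS](big_mkord xpredT (fun m => (if (v.+1 <= m)%N then ell (m - v.+1)%N / (m - v.+1)`!%:R else 0) * x%:C ^+ m)).
  rewrite (big_cat_nat (n := v.+1)) ?leq_addl //= [X in _ = X + _]big_nat [X in _ = X + _]big1 ?add0r; last first.
    by move=> m /andP[_ mv]; rewrite leqNgt mv /= mul0r.
  rewrite -{2}[v.+1]add0n big_addn /N addnK big_mkord mulr_sumr.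
  by apply: eq_bigr => m _; rewrite leq_addl addnK exprD; ring.
have := bigO0_poly_eq0 h4 (m := n + v.+1).
rewrite /N addSn ltnS leqnn => /(_ isT); rewrite /d leq_addl addnK => /eqP.
by rewrite subr_eq0 => /eqP.
Qed.

End special_values.

(** * The sequence (-1)^N chi(N) *)

Section character_sign.
Variables (R : realType) (f : nat) (chi : int -> R[i]).
Hypotheses (f0 : (0 < f)%N) (hf : odd f) (hchi : dirichlet_character f chi).

Definition signed_char (N : nat) : R[i] := (-1) ^+ N * chi N%:Z.

Lemma dchar_periodM (A M : nat) : chi (A + M * f)%N%:Z = chi A%:Z.
Proof.
elim: M => [|M IH]; first by rewrite mul0n addn0.
by rewrite mulSn addnCA addnC PoszD (dchar_period hchi).
Qed.

(** The character has period [f], while the sign changes with every step because [f] is odd. *)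
Lemma signed_char_anti (A M : nat) : signed_char (A + M * f)%N = (-1) ^+ M * signed_char A.
Proof.
rewrite /signed_char dchar_periodM exprD mulrA [_ * (-1) ^+ (M * f)]mulrC.
by congr (_ * _ * _); rewrite mulnC exprM -signr_odd hf expr1.
Qed.

Lemma signed_char_bounded : exists B : R, forall N, modc (signed_char N) <= B.
Proof.
exists (\sum_(r < f) modc (chi (r : nat)%:Z)) => N.
rewrite /signed_char modcM modcX modcN modc1 expr1n mul1r.
rewrite (divn_eq N f) addnC dchar_periodM.
rewrite (bigD1 (Ordinal (ltn_pmod N f0))) //= lerDl sumr_ge0 // => r _.
exact: modc_ge0.
Qed.

End character_sign.

(** * Linear combinations of entire functions *)

Lemma derivable_lincomb (K : numFieldType) (k : K) (F G : K -> K) (s : K) :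
  derivable (F : K^o -> K^o) s 1 -> derivable (G : K^o -> K^o) s 1 ->
  derivable ((fun z => k * F z + G z) : K^o -> K^o) s 1.
Proof.
move=> hF hG; have hZ := @derivableZ _ _ _ (F : K^o -> K^o) k s 1 hF.
exact: (derivableD hZ hG).
Qed.

Section entire_functions.
Variable R : realType.

Lemma entire_lincomb (I : Type) (r : seq I) (c : I -> R[i]) (F : I -> R[i] -> R[i]) :
  (forall i, entire (F i)) -> entire (fun s => \sum_(i <- r) c i * F i s).
Proof.
move=> h; elim: r => [|i r IH] s.
  rewrite (_ : (fun z => _) = cst 0); last by apply/funext => z; rewrite big_nil.
  exact: (@derivable_cst _ (R[i]^o) (R[i]^o)).
rewrite (_ : (fun z => _) = (fun z => c i * F i z + \sum_(i <- r) c i * F i z)).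
  exact: derivable_lincomb (h i s) (IH s).
by apply/funext => z; rewrite big_cons.
Qed.

End entire_functions.

(** * Absolute convergence of the weighted single series for Re s > w *)

Section absolutely_convergent_region.
Variables (R : realType) (v f A : nat) (s : R[i]).
Hypotheses (f0 : (0 < f)%N) (A0 : (0 < A)%N) (s_gt : v.+1%:R < Re s).

(** The binomial is at most [(v + 1)^v (i + 1)^v] and [A + i f >= i + 1], so the terms are
    [O((i + 1)^(v - Re s))] with [Re s - v > 1]. *)
Lemma weighted_powNC_summable : exists2 M : nat -> R, cvgn (series M) &
  forall i, 'C(i + v, v)%:R * modc (powNC s (A + i * f)%N) <= M i.
Proof.
exists (((v.+1 ^ v)%:R : R) *: (fun i : nat => expR (- (Re s - v%:R) * ln i.+1%:R))).
  apply: is_cvg_seriesZ; apply: is_cvg_series_pseries.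
  by move: s_gt; rewrite -natr1; lra.
move=> i.
have s0 : 0 < Re s by apply: le_lt_trans s_gt.
have -> : (((v.+1 ^ v)%:R : R) *: (fun i : nat => expR (- (Re s - v%:R) * ln i.+1%:R))) i =
   ((v.+1 ^ v)%:R * i.+1%:R ^+ v) * expR (- Re s * ln i.+1%:R).
  rewrite -[RHS]mulrA; congr (_ * _).
  have -> : i.+1%:R ^+ v = expR (v%:R * ln i.+1%:R) :> R by rewrite expRM_natl lnK ?posrE.
  by rewrite -expRD; congr expR; ring.
apply: ler_pM; rewrite ?modc_ge0 //.
  rewrite -natrX -natrM ler_nat -expnMn; apply: leq_trans (bin_le_expn _ _) _.
  by case: (v) => [//|v']; rewrite leq_exp2r //; nia.
rewrite /powNC modc_expC ReM /= mulr0 subr0 ReN ler_expR !mulNr lerN2 ler_pM2l //.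
by rewrite ler_ln ?posrE ?ltr0n ?ler_nat //; nia.
Qed.

Lemma cvgc_alternating_series : exists l,
  cvgc (series (fun i => (-1) ^+ i * 'C(i + v, v)%:R * powNC s (A + i * f)%N)) l.
Proof.
have [M cM hM] := weighted_powNC_summable.
apply: is_cvg_series_modc cM => i.
by rewrite 2!modcM modcX modcN modc1 expr1n mul1r modc_nat.
Qed.

End absolutely_convergent_region.

(** * Analytic continuation of the L-series and its values at negative integers *)

Theorem theorem1 (R : realType) (w f : nat) (chi : int -> R[i])
    (hw : (0 < w)%N) (hchi : primitive_character f chi) (hf : odd f) :
  (forall s : R[i], w%:R < complex.Re s -> genocchi_L_cvg w chi s) /\
  exists Lc : R[i] -> R[i],
    [/\ entire Lc,
        (forall s : R[i], w%:R < complex.Re s -> Lc s = genocchi_L w chi s) &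
        (forall G : nat -> R[i], genocchi_numbers w f chi G ->
         forall n : nat, (0 < n)%N ->
           Lc (- n%:R) = G (n + w)%N / ('C(n + w, w)%:R * w`!%:R))].
Proof.
case: w hw => [//|v] _; have [f0 dchi _] := hchi.
pose c := signed_char chi.
have [B hB] := signed_char_bounded f0 dchi.
have c_anti := signed_char_anti hf dchi.
have total_gt0 (a : {ffun 'I_v.+1 -> 'I_f}) : (0 < total a)%N by rewrite big_ord_recl.
have /boolp.choice[F hF] : forall a : {ffun 'I_v.+1 -> 'I_f}, exists F : R[i] -> R[i],
    entire F /\ forall s, cvgc (series (hasse_term f v (powNC s) (total a))) (F s).
  by move=> a; apply: hasse_entire.
have eF a : entire (F a) by have [] := hF a.
have cF (a : {ffun 'I_v.+1 -> 'I_f}) s : cvgc (series (hasse_term f v (powNC s) (total a))) (F a s).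
  by have [] := hF a.
pose Lc s := \sum_(a : {ffun 'I_v.+1 -> 'I_f}) c (total a) * F a s.
(* The Hasse terms contain [2^w], hence the division to reach the bare unordered sum. *)
have key s : v.+1%:R < Re s ->
    summability.partial_sum (genocchi_L_term (w := v.+1) chi s) @ summability.totally
      --> (Lc s / 2 ^+ v.+1 : R[i]^o).
  move=> hs.
  have /boolp.choice[la hla] : forall a : {ffun 'I_v.+1 -> 'I_f}, exists l, cvgc (series (fun M =>
     (-1) ^+ M * 'C(M + v, v)%:R * powNC s (total a + M * f)%N)) l.
    by move=> a; apply: cvgc_alternating_series.
  have Fla a : F a s = 2 ^+ v.+1 * la a.
    have [M cM hM] := weighted_powNC_summable f0 (total_gt0 a) hs.
    exact: euler_transform hM cM (cF a s) (hla a).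
  have -> : Lc s / 2 ^+ v.+1 = \sum_(a : {ffun 'I_v.+1 -> 'I_f}) c (total a) * la a.
    rewrite mulr_suml; apply: eq_bigr => a _; rewrite Fla.
    by field; rewrite expf_neq0 // pnatr_eq0.
  have := cvg_unordered_sum f0 c_anti hB hs hla.
  rewrite (_ : L_term _ _ = genocchi_L_term (w := v.+1) chi s) //.
  apply/funext => k; rewrite /L_term /genocchi_L_term /signed_char /powNC /natpowC.
  by rewrite mulNr expCN [(-1) ^+ _ * _]mulrC.
split=> [s hs|].
  by apply/cvg_ex; exists (Lc s / 2 ^+ v.+1); exact: key.
exists Lc; split.
- exact: (@entire_lincomb R {ffun 'I_v.+1 -> 'I_f} (index_enum _) (fun a => c (total a)) F eF).
- move=> s hs; rewrite /genocchi_L /summability.sum.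
  rewrite (cvgc_lim summability.totally_filter (key s hs)) mulrCA divff ?mulr1 //.
- move=> G hG n _.
  have h := @genocchi_coefficients R v f c G n f0 hG.
  have -> : Lc (- n%:R) = \sum_(a : {ffun 'I_v.+1 -> 'I_f}) c (total a) * hasse_value R v f (total a) n.
    apply: eq_bigr => a _; congr (_ * _).
    by apply: cvgc_unique (cF a _) _; apply: cvgc_hasse_value.
  have p m : m`!%:R != 0 :> R[i] by rewrite pnatr_eq0 -lt0n fact_gt0.
  (* This factorisation of [(n + w)!] cancels the [n!] left by [genocchi_coefficients]. *)
  have bf : ('C(n + v.+1, v.+1) * (v.+1`! * n`!) = (n + v.+1)`!)%N.
    by rewrite -[in RHS](@bin_fact (n + v.+1) v.+1) ?leq_addl // addnK.
  have bp : 'C(n + v.+1, v.+1)%:R != 0 :> R[i] by rewrite pnatr_eq0 -lt0n bin_gt0 leq_addl.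
  have bfR : (n + v.+1)`!%:R = 'C(n + v.+1, v.+1)%:R * (v.+1`!%:R * n`!%:R) :> R[i].
    by rewrite -bf !natrM.
  move: h; rewrite bfR; set S := \sum_a _ => h.
  have -> : S = S / n`!%:R * n`!%:R by rewrite mulfVK.
  rewrite -h; move: (p v.+1) (p n) bp.
  move: (v.+1`!%:R) (n`!%:R) ('C(_, _)%:R) => x y z x0 y0 z0.
  by field; rewrite x0 y0 z0.
Qed.
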